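(* For every integer $a \ge 3$, we have $$R(5,a) = \tfrac{175}{192}a^4 - \tfrac{3079}{480}a^3 + \tfrac{11771}{480}a^2 + \left[-\tfrac{7268}{160}, -\tfrac{7273}{160}\right] a + h(a),$$ where $$\begin{aligned} h(a) = \tfrac{1}{960}\,[\,&33600, 34019, 34072, 33627, 33152, 34915, 33624, 33947, 33472, 33507,\\ &34520, 34459, 32832, 33827, 34072, 34395, 33344, 34147, 33432, 33947,\\ &34240, 33699, 33752, 34267, 32832, 34595, 34264, 33627, 33152, 34147,\\ &34200, 34139, 33472, 33507, 33752, 35035, 33024, 33827, 34072, 33627,\\ &33920, 34339, 33432, 33947, 33472, 34275, 33944, 34267, 32832, 33827,\\ &34840, 33819, 33152, 34147, 33432, 34715, 33664, 33507, 33752, 34267\,]. \end{aligned}$$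
   Context: A finite lattice is graded of rank $3$ if every maximal chain (from bottom to top) has exactly four elements; its elements then lie on four levels: the bottom, the atoms (elements covering the bottom), the coatoms (elements covered by the top), and the top. For integers $c, a \ge 1$, $R(c,a)$ denotes the number of unlabeled graded lattices of rank $3$ (that is, the number of isomorphism classes of such lattices) with exactly $c$ coatoms and exactly $a$ atoms. Notation: in a formula depending on an integer variable $a$, the bracket $[c_0, c_1, \ldots, c_{M-1}]$ with $M$ entries denotes the quantity that takes the value $c_k$ when $a \equiv k \pmod M$, $0 \le k \le M-1$. For example $[3,-3]$ means $3$ if $a$ is even and $-3$ if $a$ is odd. The bracket in the definition of $h(a)$ has $M = 60$ entries, listed in order row by row. *)

(* Defs.v *)
From mathcomp Require Import all_boot all_order all_fingroup all_algebra.

Set Implicit Arguments.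
Unset Strict Implicit.
Unset Printing Implicit Defensive.

Import GRing.Theory.
Local Open Scope ring_scope.

(* So that the order structures on a finite carrier [T] can be counted, an    *)
(* order on [T] is given by its graph [r : {set T * T}].                      *)
Section Rank3.

Variable T : finType.
Implicit Types (r : {set T * T}) (C : {set T}) (x y z : T).

Definition le_of r : rel T := fun x y => (x, y) \in r.

Definition lt_of r : rel T := fun x y => (x != y) && le_of r x y.

Definition is_porder r : bool :=
  [&& [forall x, le_of r x x],
      [forall x, forall y, le_of r x y && le_of r y x ==> (x == y)]
    & [forall x, forall y, forall z,
         le_of r x y && le_of r y z ==> le_of r x z]].

Definition is_meet r x y m : bool :=
  [&& le_of r m x, le_of r m y
    & [forall z, le_of r z x && le_of r z y ==> le_of r z m]].

Definition is_join r x y j : bool :=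
  [&& le_of r x j, le_of r y j
    & [forall z, le_of r x z && le_of r y z ==> le_of r j z]].

Definition is_lattice r : bool :=
  is_porder r &&
  [forall x, forall y, [exists m, is_meet r x y m] && [exists j, is_join r x y j]].

Definition is_chain r C : bool :=
  [forall x in C, forall y in C, le_of r x y || le_of r y x].

(* [maxset] is maximality for inclusion; in a finite lattice a maximal chain  *)
(* automatically contains the bottom and the top.                             *)
Definition graded_rank3 r : bool :=
  [forall C : {set T}, maxset (is_chain r) C ==> (#|C| == 4)%N].

Definition covers r x y : bool :=
  lt_of r x y && [forall z, ~~ (lt_of r x z && lt_of r z y)].

Definition is_bottom r x : bool := [forall y, le_of r x y].

Definition is_top r x : bool := [forall y, le_of r y x].

Definition atoms r : {set T} :=
  [set x | [exists b, is_bottom r b && covers r b x]].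

Definition coatoms r : {set T} :=
  [set x | [exists t, is_top r t && covers r x t]].

Definition rank3_lattices (c a : nat) : {set {set T * T}} :=
  [set r | [&& is_lattice r, graded_rank3 r,
               #|coatoms r| == c & #|atoms r| == a]].

Definition isomorphic : rel {set T * T} := fun r r' =>
  [exists s : {perm T}, forall x, forall y,
     le_of r' (s x) (s y) == le_of r x y].

End Rank3.

(* In a graded lattice of rank 3 the bottom, the atoms, the coatoms and the   *)
(* top partition the elements: an element that is both an atom and a coatom   *)
(* would lie in a maximal chain with three elements, and an element on none   *)
(* of the four levels would lie in a chain with five.  So a lattice with c    *)
(* coatoms and a atoms has exactly c + a + 2 elements, and every isomorphism  *)
(* class has a representative with carrier 'I_(c + a + 2).                    *)
Definition R (c a : nat) : nat :=
  #|equivalence_partition (@isomorphic 'I_(c + a + 2))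
                          (rank3_lattices 'I_(c + a + 2) c a)|.

Definition bracket (s : seq rat) (a : nat) : rat := s`_(a %% size s).

(* The entries are nat numerals because ring_scope numerals are parsed in     *)
(* unary, which overflows the stack at this size.                             *)
Definition h (a : nat) : rat :=
  1 / 960%:R * bracket [seq n%:R | n <-
    [:: 33600; 34019; 34072; 33627; 33152; 34915; 33624; 33947; 33472; 33507;
        34520; 34459; 32832; 33827; 34072; 34395; 33344; 34147; 33432; 33947;
        34240; 33699; 33752; 34267; 32832; 34595; 34264; 33627; 33152; 34147;
        34200; 34139; 33472; 33507; 33752; 35035; 33024; 33827; 34072; 33627;
        33920; 34339; 33432; 33947; 33472; 34275; 33944; 34267; 32832; 33827;
        34840; 33819; 33152; 34147; 33432; 34715; 33664; 33507; 33752; 34267]%N] a.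

(* Main.v *)
(* A lattice of rank 3 is its atom-coatom incidence relation, in which two
   atoms have at most one common upper coatom.  Recording an atom by the set of
   coatoms above it, a lattice with c labeled coatoms amounts to a linear space
   on c points (its lines are the sets of size at least 2) together with the
   number m_i of atoms lying under the i-th coatom only, where m_i > 0 unless
   some line contains i; isomorphism is relabeling of the c points.

   By Burnside's lemma, c! R(c,a) is the sum over the permutations p and over
   the linear spaces H fixed by p of the number of p-invariant admissible m of
   total a - |H|.  Subtracting 1 from m at the isolated points of H, this is the
   number of ways to write a - |H| - #isolated as a nonnegative combination of
   the cycle lengths of p.  For c = 5 these lengths divide 60, so that both this
   sum and the claimed formula are annihilated by the fifth power of
   u |-> (n |-> u(n + 60) - u(n)) once n is at least 11; it remains to compare
   them for 3 <= a <= 310, which is done by computation. *)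
From Stdlib Require Import NArith.
Require Import Defs.
From mathcomp Require Import all_boot all_order all_fingroup all_algebra.
From mathcomp Require Import zify ring lra.

Set Implicit Arguments.
Unset Strict Implicit.
Unset Printing Implicit Defensive.

Import GRing.Theory Num.Theory.

(** * Lattices of rank 3 and labeled configurations *)

(** Two distinct atoms under two common coatoms would have a join strictly above the atoms and
    strictly below one of those coatoms, hence a chain of five elements; conversely this single
    condition is what makes meets and joins exist.

    An element is labeled by its kind. A labeling with prescribed fibre sizes is unique up to a
    permutation of the carrier, and the kinds determine the order, so only the relabeling of coatoms
    is left of an isomorphism.

    The exponent 5 is the largest number of cycles: a difference of step 60 turns a denumerant with
    parts d, l into a sum of shifts of the denumerant with parts l. The onset 11 is 1 plus 10, the
    largest value of |H| + #isolated, attained by the ten 2-point lines. So 5 * 60 consecutive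
    values from 11 on decide the identity, and the smaller a are checked directly.

    The number 5 enters only through evaluation; the reduction to lists holds for any positive
    number of coatoms. *)

(** The classes are the nonempty fibres of f. In [R_orbits], f sends a lattice to the orbit of a
    configuration representing it. *)
Lemma card_equivalence_partition_image (X Y : finType) (e : rel X)
    (D : {set X}) (f : X -> Y) :
    {in D &, forall x y, e x y = (f x == f y)} ->
  #|equivalence_partition e D| = #|f @: D|.
Proof.
move=> ef; pose fib (y : Y) := [set x in D | y == f x].
have ->: equivalence_partition e D = fib @: (f @: D).
  rewrite -imset_comp; apply: eq_in_imset => x xD.
  by apply/setP=> y; rewrite !inE; case yD: (y \in D); rewrite //= ef.
apply: card_in_imset => _ _ /imsetP[x xD ->] /imsetP[y yD ->] /setP/(_ x).
by rewrite !inE xD eqxx /= => /esym/eqP.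
Qed.

Lemma card_setP_fibers (X K : finType) (t : X -> K) (P : pred K) :
  #|[set x | P (t x)]| = \sum_(k | P k) #|[set x | t x == k]|.
Proof.
rewrite -sum1_card (partition_big t P) /=; last by move=> x; rewrite inE.
apply: eq_bigr => k Pk; rewrite -sum1_card; apply: eq_bigl => x.
by rewrite !inE; case: eqP => [->|]; rewrite ?Pk ?andbF.
Qed.

Lemma card_fiber_count n (K : eqType) (t : 'I_n -> K) k :
  #|[set x | t x == k]| = count_mem k [seq t x | x <- enum 'I_n].
Proof.
rewrite -sum1_count big_map big_enum_cond -sum1_card.
by apply: eq_bigl => x; rewrite !inE.
Qed.

(** The value lists of f and g have the same multiplicities, so one is a permutation of the
    other. *)
Lemma same_fibers_perm n (K : finType) (f g : 'I_n -> K) :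
    (forall k, #|[set x | f x == k]| = #|[set x | g x == k]|) ->
  exists s : {perm 'I_n}, forall x, g (s x) = f x.
Proof.
move=> fg.
have /tuple_permP[s /(congr1 (fun u => nth _ u _)) E] :
    perm_eq [tuple f i | i < n] [tuple g i | i < n].
  by apply/allP => k _ /=; rewrite -!card_fiber_count fg.
exists s => x; have := E (f x) x.
by rewrite !nth_mktuple tnth_mktuple.
Qed.

Lemma exists_fibers n (K : finType) (m : K -> nat) : \sum_k m k = n ->
  exists t : 'I_n -> K, forall k, #|[set x | t x == k]| = m k.
Proof.
move=> mn; pose s := flatten [seq nseq (m k) k | k <- enum K].
have sz : size s = n.
  rewrite size_flatten /shape -map_comp sumnE big_map -mn big_enum /=.
  by apply: eq_bigr => k _; rewrite size_nseq.
have cnt k : count_mem k s = m k.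
  rewrite count_flatten -map_comp sumnE big_map big_enum /= (bigD1 k) //=.
  rewrite count_nseq /= eqxx mul1n big1 ?addn0 // => i /negPf ik.
  by rewrite count_nseq /= ik.
(* The empty list is treated apart because K may be empty, and [nth] needs a default value in K. *)
case: s sz cnt => [|k0 s] sz cnt.
  move: sz cnt => /= <- cnt; exists (fun x : 'I_0 => match notF (ltn_ord x) with end).
  by move=> k; rewrite -cnt; apply/eqP; rewrite cards_eq0; apply/eqP/setP=> -[].
exists (fun x => nth k0 (k0 :: s) x) => k; rewrite card_fiber_count -cnt.
congr (count _ _); rewrite -{2}(mkseq_nth k0 (k0 :: s)) /mkseq sz -val_enum_ord.
by rewrite -map_comp.
Qed.

(* [inl false] is the bottom, [inl true] the top, and an atom is recorded by the
   set of the coatoms above it. *)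
Definition kind c := (bool + ('I_c + {set 'I_c}))%type.

Notation Bot := (inl false).
Notation Top := (inl true).
Notation Coatom i := (inr (inl i)).
Notation Atom e := (inr (inr e)).

Definition below c (k1 k2 : kind c) : bool :=
  match k1, k2 with
  | Bot, Bot => false
  | Bot, _ => true
  | Top, _ => false
  | _, Top => true
  | Atom e, Coatom i => i \in e
  | _, _ => false
  end.

Definition graph_of c (T : finType) (t : T -> kind c) : {set T * T} :=
  [set p | (p.1 == p.2) || below (t p.1) (t p.2)].

(* The set of lines, and for each i the number of atoms lying under the i-th
   coatom only; the bound a on these numbers only serves finiteness. *)
Definition config c a := ({set {set 'I_c}} * {ffun 'I_c -> 'I_a.+1})%type.

(** Often called a partial linear space: two points may lie on no common line, and 2-point lines are
    optional. *)
Definition linear_space c (H : {set {set 'I_c}}) : bool :=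
  [forall e in H, 1 < #|e|] &&
  [forall e in H, forall f in H, (e != f) ==> (#|e :&: f| <= 1)].

Definition admissible c a (d : config c a) : bool :=
  [&& linear_space d.1,
      [forall i, (i \notin cover d.1) ==> (0 < d.2 i)]
    & #|d.1| + \sum_i d.2 i == a].

(** For admissible d the two terms at an atom never overlap: lines have at least two points, and the
    sum is empty unless e is a singleton. The empty set gets multiplicity 0, as every atom must lie
    under some coatom. *)
Definition mult c a (d : config c a) (k : kind c) : nat :=
  if k is Atom e then (e \in d.1) + \sum_(i | e == [set i]) d.2 i else 1.

Lemma sum_atom_mult c a (d : config c a) :
  \sum_e mult d (Atom e) = #|d.1| + \sum_i d.2 i.
Proof.
rewrite big_split -sum1_card [in RHS]big_mkcond /=.
congr (_ + _); rewrite (exchange_big_dep predT) //=.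
by apply: eq_bigr => i _; rewrite big_pred1_eq.
Qed.

Lemma card_atom_kinds c (T : finType) (t : T -> kind c) :
  #|[set x | if t x is Atom _ then true else false]| =
  \sum_e #|[set x | t x == Atom e]|.
Proof.
rewrite (card_setP_fibers t (fun k => if k is Atom _ then true else false)).
by rewrite big_sumType /= big_pred0 // add0n big_sumType /= big_pred0.
Qed.

(** * The lattice built from an admissible configuration *)

Section Graph.

Variables (c a : nat) (T : finType) (d : config c a) (t : T -> kind c).
Hypothesis c_gt0 : 0 < c.
Hypothesis dV : admissible d.
Hypothesis tD : forall k, #|[set x | t x == k]| = mult d k.

Implicit Types (x y z w : T) (i j : 'I_c) (e f g : {set 'I_c}) (k l : kind c).

Local Notation r := (graph_of t).

Lemma config_card e : e \in d.1 -> 1 < #|e|.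
Proof. by case/and3P: dV => /andP[/forall_inP+ _] _ _; apply. Qed.

Lemma config_inter e f i j : e \in d.1 -> f \in d.1 -> i != j ->
  i \in e -> j \in e -> i \in f -> j \in f -> e = f.
Proof.
move=> eH fH ij ie je if_ jf; apply/eqP; case: (boolP (e == f)) => // ef.
case/and3P: dV => /andP[_ /forall_inP/(_ _ eH)/forall_inP/(_ _ fH)] + _ _.
rewrite ef leqNgt => /negP[].
by apply/card_gt1P; exists i, j; rewrite !inE ie je if_ jf.
Qed.

Lemma mult_big e : 1 < #|e| -> mult d (Atom e) = (e \in d.1).
Proof.
move=> e2; rewrite /mult big1 ?addn0 // => i /eqP ei.
by rewrite ei cards1 in e2.
Qed.

Lemma mult1 i : mult d (Atom [set i]) = d.2 i.
Proof.
rewrite /mult (big_pred1 i) => [|j]; last by rewrite (inj_eq set1_inj) eq_sym.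
by case: (boolP (_ \in _)) => // /config_card; rewrite cards1.
Qed.

Lemma mult0 : mult d (Atom set0) = 0.
Proof.
rewrite /mult big1 ?addn0 => [|i /eqP/setP/(_ i)]; last by rewrite !inE eqxx.
by case: (boolP (_ \in _)) => // /config_card; rewrite cards0.
Qed.

Lemma kind_exists k : 0 < mult d k -> exists x, t x = k.
Proof. by rewrite -tD => /card_gt0P[x]; rewrite inE => /eqP xk; exists x. Qed.

Lemma kind_inj k x y : mult d k <= 1 -> t x = k -> t y = k -> x = y.
Proof.
rewrite -tD => /card_le1_eqP/(_ y x); rewrite !inE => xy xk yk.
by apply: xy; rewrite ?xk ?yk.
Qed.

Lemma kind_mult x : 0 < mult d (t x).
Proof. by rewrite -tD; apply/card_gt0P; exists x; rewrite inE. Qed.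

Lemma atom_neq0 x e : t x = Atom e -> exists i, i \in e.
Proof.
move=> xe; apply/set0Pn/eqP => e0.
by have := kind_mult x; rewrite xe e0 mult0.
Qed.

Lemma atom_inj x y e f i j : t x = Atom e -> t y = Atom f -> i != j ->
  i \in e -> j \in e -> i \in f -> j \in f -> x = y.
Proof.
move=> xe yf ij ie je if_ jf.
have big g : i \in g -> j \in g -> 1 < #|g|.
  by move=> ig jg; apply/card_gt1P; exists i, j.
have memH z g : i \in g -> j \in g -> t z = Atom g -> g \in d.1.
  move=> ig jg zg; have := kind_mult z; rewrite zg mult_big ?big //.
  by case: (_ \in _).
apply: (@kind_inj (Atom e)) => //; first by rewrite mult_big ?big ?leq_b1.
by rewrite yf (@config_inter e f i j) //; [apply: memH xe | apply: memH yf].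
Qed.

Lemma coatom_below i : exists x e, t x = Atom e /\ i \in e.
Proof.
case/and3P: dV => _ /forallP/(_ i) + _.
case: (boolP (i \in cover d.1)) => [/bigcupP[e eH ie] _|_ /= mi].
  by have [|x xe] := @kind_exists (Atom e); [rewrite /= eH | exists x, e].
have [|x xe] := @kind_exists (Atom [set i]); first by rewrite mult1.
by exists x, [set i]; rewrite inE.
Qed.

Lemma mem_graph x y : le_of r x y = (x == y) || below (t x) (t y).
Proof. by rewrite /le_of inE. Qed.

Lemma below_irr k : below k k = false :> bool.
Proof. by case: (k : kind c) => [[]|[]]. Qed.

Lemma below_trans (k2 k1 k3 : kind c) : below k1 k2 -> below k2 k3 -> below k1 k3.
Proof. by case: k1 k2 k3 => [[]|[i1|e1]] [[]|[i2|e2]] [[]|[i3|e3]]. Qed.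

Lemma lt_graph x y : lt_of r x y = below (t x) (t y).
Proof.
rewrite /lt_of mem_graph; case: eqP => [->|] //=.
by rewrite below_irr.
Qed.

Lemma graph_porder : is_porder r.
Proof.
apply/and3P; split.
- by apply/forallP => x; rewrite mem_graph eqxx.
- apply/forallP => x; apply/forallP => y; apply/implyP; rewrite !mem_graph.
  case: eqP => //= xy; rewrite eq_sym; case: eqP => //= _ /andP[b1 b2].
  by have := below_trans b1 b2; rewrite below_irr.
- apply/forallP => x; apply/forallP => y; apply/forallP => z; apply/implyP.
  rewrite !mem_graph => /andP[/orP[/eqP->//|b1] /orP[/eqP<-|b2]].
    by rewrite b1 orbT.
  by rewrite (below_trans b1 b2) orbT.
Qed.

Lemma exists_bot : exists x, t x = Bot. Proof. exact: kind_exists. Qed.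
Lemma exists_top : exists x, t x = Top. Proof. exact: kind_exists. Qed.

Lemma below_bot x y : t x = Bot -> le_of r x y.
Proof.
move=> xb; rewrite mem_graph xb; case yb: (t y) => [[]|] //=; rewrite ?orbT //.
by rewrite (kind_inj _ xb yb) // eqxx.
Qed.

Lemma below_top x y : t y = Top -> le_of r x y.
Proof.
move=> yt; rewrite mem_graph yt; case xt: (t x) => [[]|[]] //=; rewrite ?orbT //.
by rewrite (kind_inj _ xt yt) // eqxx.
Qed.

Lemma graph_refl x : le_of r x x.
Proof. by rewrite mem_graph eqxx. Qed.

Lemma incomparable_kinds x y : ~~ le_of r x y -> ~~ le_of r y x ->
  [/\ x != y, exists u, t x = inr u & exists u, t y = inr u].
Proof.
case: (eqVneq x y) => [->|xy]; first by rewrite graph_refl.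
case xk: (t x) => [[]|u]; first by rewrite (below_top y xk).
  by rewrite (below_bot y xk).
case yk: (t y) => [[]|v]; first by rewrite (below_top x yk).
  by rewrite (below_bot x yk).
by split=> //; [exists u | exists v].
Qed.

(** For incomparable x and y, a lower bound other than the bottom is an atom under two different
    coatoms, and by [atom_inj] there is at most one such atom. *)
Lemma graph_meet x y : exists m, is_meet r x y m.
Proof.
case: (boolP (le_of r x y)) => [xy|nxy].
  by exists x; apply/and3P; split=> //; [exact: graph_refl
    | apply/forallP => z; apply/implyP => /andP[]].
case: (boolP (le_of r y x)) => [yx|nyx].
  by exists y; apply/and3P; split=> //; [exact: graph_refl
    | apply/forallP => z; apply/implyP => /andP[]].
have [xy [k xk] [l yl]] := incomparable_kinds nxy nyx.
have shape z : t z != Bot -> le_of r z x -> le_of r z y ->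
    exists i j e, [/\ t x = Coatom i, t y = Coatom j, t z = Atom e &
                      [/\ i != j, i \in e & j \in e]].
  move=> zb zx zy; move: (zx) (zy); rewrite !mem_graph.
  case: eqP => [zx'|_]; first by rewrite zx' (negPf nxy) in zy.
  case: eqP => [zy'|_] /=; first by rewrite zy' (negPf nyx) in zx.
  rewrite xk yl; case ze: (t z) zb => [[]|[i|e]] //= _.
  case: k xk => //= i xi ie; case: l yl => //= j yj je.
  exists i, j, e; split=> //; split=> //; apply: contraNneq xy => ij.
  by apply/eqP; apply: (kind_inj _ xi) => //; rewrite ij.
case: (pickP (fun z => [&& t z != Bot, le_of r z x & le_of r z y])) => [z|none].
  case/and3P => zb zx zy; exists z; apply/and3P; split=> //.
  apply/forallP => w; apply/implyP => /andP[wx wy].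
  case: (boolP (t w == Bot)) => [/eqP wb|wb]; first exact: below_bot.
  have [i [j [e [xi yj ze [ij ie je]]]]] := shape z zb zx zy.
  have [i' [j' [f [xi' yj' wf [_ if_ jf]]]]] := shape w wb wx wy.
  move: xi' yj'; rewrite xi yj => -[ii'] [jj']; subst i' j'.
  by rewrite (atom_inj wf ze ij) ?graph_refl.
have [b bb] := exists_bot; exists b.
apply/and3P; split; [exact: below_bot | exact: below_bot |].
apply/forallP => w; apply/implyP => /andP[wx wy].
have := none w; rewrite wx wy !andbT => /negbFE/eqP wb.
exact: below_bot.
Qed.

(** For incomparable x and y, an upper bound other than the top is a coatom above two distinct
    atoms. A second one would give these atoms two common coatoms, against [atom_inj]. *)
Lemma graph_join x y : exists m, is_join r x y m.
Proof.
case: (boolP (le_of r x y)) => [xy|nxy].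
  by exists y; apply/and3P; split=> //; [exact: graph_refl
    | apply/forallP => z; apply/implyP => /andP[]].
case: (boolP (le_of r y x)) => [yx|nyx].
  by exists x; apply/and3P; split=> //; [exact: graph_refl
    | apply/forallP => z; apply/implyP => /andP[]].
have [xy [k xk] [l yl]] := incomparable_kinds nxy nyx.
have shape z : t z != Top -> le_of r x z -> le_of r y z ->
    exists e f i, [/\ t x = Atom e, t y = Atom f, t z = Coatom i &
                      (i \in e) && (i \in f)].
  move=> zb zx zy; move: (zx) (zy); rewrite !mem_graph.
  case: eqP => [zx'|_]; first by rewrite -zx' (negPf nyx) in zy.
  case: eqP => [zy'|_] /=; first by rewrite -zy' (negPf nxy) in zx.
  rewrite xk yl; case zi: (t z) zb => [[]|[i|e]] //= _; first last.
  - by case: k xk.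
  - case: k xk => // e xe ie; case: l yl => // f yf if_.
    by exists e, f, i; rewrite ie if_.
  - by case: k xk.
case: (pickP (fun z => [&& t z != Top, le_of r x z & le_of r y z])) => [z|none].
  case/and3P => zb zx zy; exists z; apply/and3P; split=> //.
  apply/forallP => w; apply/implyP => /andP[wx wy].
  case: (boolP (t w == Top)) => [/eqP wb|wb]; first exact: below_top.
  have [e [f [i [xe yf zi /andP[ie if_]]]]] := shape z zb zx zy.
  have [e' [f' [j [xe' yf' wj]]]] := shape w wb wx wy.
  move: xe' yf'; rewrite xe yf => -[ee'] [ff']; subst e' f' => /andP[je jf].
  case: (eqVneq i j) => [ij|ij].
    by rewrite ij in zi; rewrite (kind_inj _ zi wj) ?graph_refl.
  by rewrite (atom_inj xe yf ij) ?eqxx in xy.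
have [b bb] := exists_top; exists b.
apply/and3P; split; [exact: below_top | exact: below_top |].
apply/forallP => w; apply/implyP => /andP[wx wy].
have := none w; rewrite wx wy !andbT => /negbFE/eqP wb.
exact: below_top.
Qed.

Lemma graph_lattice : is_lattice r.
Proof.
rewrite /is_lattice graph_porder; apply/forallP => x; apply/forallP => y.
by apply/andP; split; apply/existsP; [exact: graph_meet | exact: graph_join].
Qed.

Lemma is_bottom_graph x : is_bottom r x = (t x == Bot).
Proof.
apply/idP/eqP => [/forallP xb|xb]; last by apply/forallP => y; exact: below_bot.
have [b bb] := exists_bot; have := xb b; rewrite mem_graph => /orP[/eqP->//|].
by rewrite bb; case: (t x) => [[]|[]].
Qed.

Lemma is_top_graph x : is_top r x = (t x == Top).
Proof.
apply/idP/eqP => [/forallP xb|xb]; last by apply/forallP => y; exact: below_top.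
have [b bb] := exists_top; have := xb b; rewrite mem_graph => /orP[/eqP<-//|].
by rewrite bb.
Qed.

Lemma atoms_graph x : x \in atoms r = if t x is Atom _ then true else false.
Proof.
rewrite inE; apply/existsP/idP => [[b]|].
  rewrite is_bottom_graph /covers lt_graph => /and3P[/eqP bb + /forallP none].
  rewrite bb; case xk: (t x) => [[]|[i|e]] // _.
    have [y [e [ye ie]]] := coatom_below (Ordinal c_gt0).
    by have := none y; rewrite !lt_graph bb ye xk.
  have [y [e [ye ie]]] := coatom_below i.
  by have := none y; rewrite !lt_graph bb ye xk /= ie.
case xk: (t x) => [|[|e]] // _; have [b bb] := exists_bot; exists b.
rewrite is_bottom_graph bb eqxx /covers lt_graph bb xk; apply/forallP => z.
by rewrite !lt_graph bb xk; case: (t z) => [[]|[]].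
Qed.

Lemma coatoms_graph x : x \in coatoms r = if t x is Coatom _ then true else false.
Proof.
rewrite inE; apply/existsP/idP => [[b]|].
  rewrite is_top_graph /covers lt_graph => /and3P[/eqP bb + /forallP none].
  rewrite bb; case xk: (t x) => [[]|[i|e]] // _.
    have [y [e [ye ie]]] := coatom_below (Ordinal c_gt0).
    by have := none y; rewrite !lt_graph bb ye xk.
  have [i ie] := atom_neq0 xk; have [//|y yi] := @kind_exists (Coatom i).
  by have := none y; rewrite !lt_graph bb yi xk /= ie.
case xk: (t x) => [|[i|e]] // _; have [b bb] := exists_top; exists b.
rewrite is_top_graph bb eqxx /covers lt_graph bb xk; apply/forallP => z.
by rewrite !lt_graph bb xk; case: (t z) => [[]|[]].
Qed.

Lemma card_atoms_graph : #|atoms r| = a.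
Proof.
have ->: atoms r = [set x | if t x is Atom _ then true else false].
  by apply/setP => x; rewrite atoms_graph inE.
rewrite card_atom_kinds; case/and3P: dV => _ _ /eqP da; apply: etrans da.
rewrite -sum_atom_mult.
by apply: eq_bigr => e _; rewrite tD.
Qed.

Lemma card_coatoms_graph : #|coatoms r| = c.
Proof.
have ->: coatoms r = [set x | if t x is Coatom _ then true else false].
  by apply/setP => x; rewrite coatoms_graph inE.
rewrite (card_setP_fibers t (fun k => if k is Coatom _ then true else false)).
rewrite big_sumType /= big_pred0 // add0n big_sumType /= addnC big_pred0 // add0n.
by under eq_bigr do rewrite tD; rewrite sum1_card card_ord.
Qed.

(** A chain has at most one atom and one coatom. Whichever is missing can be supplied, since every
    atom is under a coatom and every coatom is above an atom; the bottom and the top complete the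
    four elements. *)
Lemma graph_chain_extend (C : {set T}) : is_chain r C ->
  exists2 D, is_chain r D && (#|D| == 4) & C \subset D.
Proof.
move=> Cch; have comp x y : x \in C -> y \in C -> x != y ->
    below (t x) (t y) || below (t y) (t x).
  move=> xC yC xy; have /forall_inP/(_ x xC)/forall_inP/(_ y yC) := Cch.
  by rewrite !mem_graph [y == x]eq_sym (negPf xy).
have [b bb] := exists_bot; have [p pp] := exists_top.
have [x [y [e [i [xe yi ie xC yC]]]]] : exists x y e i,
    [/\ t x = Atom e, t y = Coatom i, i \in e,
        forall z f, z \in C -> t z = Atom f -> z = x
      & forall z j, z \in C -> t z = Coatom j -> z = y].
  have atom1 x z e f : x \in C -> z \in C -> t x = Atom e -> t z = Atom f -> z = x.
    move=> xC zC xe zf; apply: contraTeq isT => zx.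
    by have := comp _ _ zC xC zx; rewrite xe zf.
  have coatom1 x z i j : x \in C -> z \in C -> t x = Coatom i -> t z = Coatom j -> z = x.
    move=> xC zC xe zf; apply: contraTeq isT => zx.
    by have := comp _ _ zC xC zx; rewrite xe zf.
  case: (pickP (fun x => (x \in C) && if t x is Atom _ then true else false)) => [x|na];
  case: (pickP (fun y => (y \in C) && if t y is Coatom _ then true else false)) => [y|nc].
  - case/andP=> yC; case yi: (t y) => [|[i|]] // _.
    case/andP=> xC; case xe: (t x) => [|[|e]] // _.
    exists x, y, e, i; split=> //; first last.
    + by move=> z j zC zj; exact: (coatom1 _ _ _ _ yC zC yi zj).
    + by move=> z f zC zf; exact: (atom1 _ _ _ _ xC zC xe zf).
    have := comp x y xC yC; rewrite xe yi /= orbF; apply.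
    by apply/eqP => xy; move: xe; rewrite xy yi.
  - case/andP=> xC; case xe: (t x) => [|[|e]] // _.
    have [i ie] := atom_neq0 xe; have [//|y yi] := @kind_exists (Coatom i).
    exists x, y, e, i; split=> // z j zC zj; first exact: (atom1 _ _ _ _ xC zC xe zj).
    by have := nc z; rewrite zC zj.
  - case/andP=> yC; case yi: (t y) => [|[i|]] // _.
    have [x [e [xe ie]]] := coatom_below i.
    exists x, y, e, i; split=> // z j zC zj; last exact: (coatom1 _ _ _ _ yC zC yi zj).
    by have := na z; rewrite zC zj.
  have [//|y yi] := @kind_exists (Coatom (Ordinal c_gt0)).
  have [x [e [xe ie]]] := coatom_below (Ordinal c_gt0).
  exists x, y, e, (Ordinal c_gt0); split=> // z j zC zj.
    by have := na z; rewrite zC zj.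
  by have := nc z; rewrite zC zj.
exists [set z | z \in [:: b; x; y; p]]; last first.
  apply/subsetP => z zC; rewrite !inE.
  case zk: (t z) => [[]|[j|f]].
  - by rewrite (kind_inj _ zk pp) // eqxx !orbT.
  - by rewrite (kind_inj _ zk bb) // eqxx.
  - by rewrite (yC z j zC zk) eqxx !orbT.
  - by rewrite (xC z f zC zk) eqxx !orbT.
apply/andP; split.
  apply/forall_inP => z; rewrite !inE => zD; apply/forall_inP => w; rewrite !inE.
  rewrite !mem_graph; move: zD => /or4P[] /eqP-> /or4P[] /eqP->;
    by rewrite ?eqxx ?bb ?xe ?yi ?pp /= ?ie ?orbT.
rewrite cardsE; apply/eqP; apply: (card_uniqP (s := [:: b; x; y; p])).
by apply: (@map_uniq _ _ t); rewrite /= bb xe yi pp.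
Qed.

Lemma graph_graded : graded_rank3 r.
Proof.
apply/forallP => C; apply/implyP => /maxsetP[Cch Cmax].
have [D /andP[Dch D4] CD] := graph_chain_extend Cch.
by rewrite -(Cmax D Dch CD).
Qed.

Lemma graph_rank3 : r \in rank3_lattices T c a.
Proof.
by rewrite inE graph_lattice graph_graded card_atoms_graph card_coatoms_graph !eqxx.
Qed.

End Graph.

(** * The action of permutations of the coatoms on configurations *)

Definition relabel_kind c (p : {perm 'I_c}) (k : kind c) : kind c :=
  match k with
  | inl b => inl b
  | Coatom i => Coatom (p i)
  | Atom e => Atom (p @: e)
  end.

(** Weights are pushed forward, so that p i receives the weight of i; the inverse makes this a right
    action, like the one on lines. *)
Definition relabel c a (d : config c a) (p : {perm 'I_c}) : config c a :=
  ([set p @: (e : {set _}) | e in d.1], [ffun i => d.2 ((p^-1)%g i)]).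

Section Relabel.

Local Open Scope group_scope.

Variables c a : nat.
Implicit Types (d : config c a) (p q : {perm 'I_c}) (k : kind c).
Implicit Types (i j : 'I_c) (e f g : {set 'I_c}).

Lemma imset_permM p q e : (p * q) @: e = q @: (p @: e).
Proof. by rewrite -imset_comp; apply: eq_imset => i; rewrite /= permM. Qed.

Lemma imset_perm1 e : (1 : {perm 'I_c}) @: e = e.
Proof. by rewrite -[RHS]imset_id; apply: eq_imset => i; rewrite perm1. Qed.

Lemma imset_perm_inj p : injective (fun e => p @: e).
Proof. exact: imset_inj perm_inj. Qed.

Lemma relabel1 d : relabel d 1 = d.
Proof.
case: d => H m; congr (_, _); last by apply/ffunP => i; rewrite ffunE invg1 perm1.
by rewrite -[RHS]imset_id; apply: eq_imset => e; rewrite imset_perm1.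
Qed.

Lemma relabelM d p q : relabel d (p * q) = relabel (relabel d p) q.
Proof.
congr (_, _); last by apply/ffunP => i; rewrite !ffunE invMg permM.
by rewrite /= -imset_comp; apply: eq_imset => e; rewrite imset_permM.
Qed.

Definition relabel_action := TotalAction relabel1 relabelM.

Lemma relabel_kindK p : cancel (relabel_kind p) (relabel_kind p^-1).
Proof.
case=> [//|[i|e]] /=; first by rewrite permK.
by rewrite -imset_permM mulgV imset_perm1.
Qed.

Lemma relabel_kindKV p : cancel (relabel_kind p^-1) (relabel_kind p).
Proof. by move=> k; rewrite -{1}[p]invgK relabel_kindK. Qed.

Lemma below_relabel_kind p k1 k2 :
  below (relabel_kind p k1) (relabel_kind p k2) = below k1 k2.
Proof.
case: k1 k2 => [[]|[i|e]] [[]|[j|f]] //=.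
by rewrite mem_imset //; exact: perm_inj.
Qed.

Lemma mult_relabel d p k : mult (relabel d p) (relabel_kind p k) = mult d k.
Proof.
case: k => [//|[//|e]] /=; rewrite mem_imset; last exact: imset_perm_inj.
congr (_ + _); rewrite [LHS](reindex_inj (@perm_inj _ p)) /=.
apply: eq_big => [i|i _]; last by rewrite ffunE permK.
by rewrite -imset_set1 (inj_eq (@imset_perm_inj p)).
Qed.

Lemma admissible_relabel d p : admissible (relabel d p) = admissible d.
Proof.
suff imp d0 q : admissible d0 -> admissible (relabel d0 q).
  by apply/idP/idP => [/(imp _ p^-1)|/imp]; rewrite -?relabelM ?mulgV ?relabel1.
move: d0 q => {}d {}p.
case/and3P=> /andP[/forall_inP big /forall_inP lin] /forallP cov /eqP card.
apply/and3P; split.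
- apply/andP; split; apply/forall_inP => _ /imsetP[e eH ->].
    by rewrite card_imset ?big //; exact: perm_inj.
  apply/forall_inP => _ /imsetP[f fH ->]; apply/implyP => ef.
  rewrite -imsetI => [|i j _ _]; last exact: perm_inj.
  rewrite card_imset; last exact: perm_inj.
  have /forall_inP/(_ f fH)/implyP := lin e eH; apply.
  by apply: contraNneq ef => ->.
- apply/forallP => i; apply/implyP; rewrite /= ffunE => icov.
  have /implyP := cov (p^-1 i); apply; apply: contraNN icov => /bigcupP[e eH ie].
  apply/bigcupP; exists (p @: e); first exact: imset_f.
  by apply/imsetP; exists (p^-1 i); rewrite ?permKV.
rewrite card_imset; last exact: imset_perm_inj.
apply/eqP; rewrite -[RHS]card; congr (_ + _).
rewrite [LHS](reindex_inj (@perm_inj _ p)) /=.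
by apply: eq_bigr => i _; rewrite ffunE permK.
Qed.

(** The sets of size at least 2 recover the lines, and the singletons recover the weights. *)
Lemma config_eq d d' : admissible d -> admissible d' ->
  (forall k, mult d k = mult d' k) -> d = d'.
Proof.
move=> dV dV' dd'; rewrite [d]surjective_pairing [d']surjective_pairing.
congr (_, _); last by apply/ffunP => i; apply: val_inj; rewrite /= -!mult1.
apply/setP => e; case: (leqP 2 #|e|) => [e2|e2].
  by have := dd' (Atom e); rewrite !mult_big //; do 2!case: (_ \in _).
by apply/idP/idP => [/(config_card dV)|/(config_card dV')]; rewrite leqNgt e2.
Qed.

End Relabel.

(** * Isomorphism of lattices as relabeling of configurations *)

Section Isomorphism.

Local Open Scope group_scope.

Variables (c a n : nat) (d d' : config c a) (t t' : 'I_n -> kind c).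
Implicit Types (x y : 'I_n) (i j : 'I_c) (e f : {set 'I_c}).
Hypothesis c_gt0 : 0 < c.
Hypotheses (dV : admissible d) (dV' : admissible d').
Hypothesis tD : forall k, #|[set x | t x == k]| = mult d k.
Hypothesis tD' : forall k, #|[set x | t' x == k]| = mult d' k.

Lemma relabel_isomorphic p : d' = relabel d p ->
  isomorphic (graph_of t) (graph_of t').
Proof.
move=> dp; have [k|s st] := @same_fibers_perm n _ (relabel_kind p \o t) t'.
  rewrite tD' dp -(relabel_kindKV p k) mult_relabel -tD.
  apply: eq_card => x; rewrite !inE /=.
  by rewrite (inj_eq (can_inj (relabel_kindK p))).
apply/existsP; exists s; apply/forallP => x; apply/forallP => y.
by rewrite !mem_graph !st below_relabel_kind (inj_eq perm_inj).
Qed.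

(** An isomorphism preserves the levels, hence permutes the coatoms; this is p. The kind of an atom
    is the set of coatoms above it, so p also governs the atoms, and comparing fibre sizes with
    [config_eq] concludes. *)
Lemma isomorphic_relabel : isomorphic (graph_of t) (graph_of t') ->
  exists p, d' = relabel d p.
Proof.
case/existsP => s /forallP /(_ _) /forallP /(_ _) /eqP /= iso.
have lt_iso x y : below (t' (s x)) (t' (s y)) = below (t x) (t y).
  rewrite -!lt_graph /lt_of iso (inj_eq perm_inj) //.
have bot_iso x : (t' (s x) == Bot) = (t x == Bot).
  rewrite -(is_bottom_graph tD') -(is_bottom_graph tD).
  apply/forallP/forallP => b y; first by rewrite -iso.
  by rewrite -(permKV s y) iso.
have top_iso x : (t' (s x) == Top) = (t x == Top).
  rewrite -(is_top_graph tD') -(is_top_graph tD).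
  apply/forallP/forallP => b y; first by rewrite -iso.
  by rewrite -(permKV s y) iso.
have covers_iso x y : covers (graph_of t') (s x) (s y) = covers (graph_of t) x y.
  rewrite /covers !lt_graph lt_iso; congr (_ && _).
  apply/forallP/forallP => N z; last rewrite -(permKV s z).
    by have := N (s z); rewrite !lt_graph !lt_iso.
  by have := N (s^-1 z); rewrite !lt_graph !lt_iso.
have coatom_iso x : (s x \in coatoms (graph_of t')) = (x \in coatoms (graph_of t)).
  rewrite !inE; apply/existsP/existsP => -[y].
    rewrite -(permKV s y) covers_iso (is_top_graph tD') top_iso -(is_top_graph tD).
    by exists (s^-1 y).
  rewrite -covers_iso (is_top_graph tD) -top_iso -(is_top_graph tD').
  by exists (s y).

have coatomP x i : t x = Coatom i -> exists j, t' (s x) = Coatom j.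
  move=> xi; have := coatom_iso x.
  rewrite (coatoms_graph c_gt0 dV tD) (coatoms_graph c_gt0 dV' tD') xi.
  by case: (t' _) => [|[j|]] //; exists j.
(* The default i is never taken: every kind [Coatom i] is inhabited and s sends coatoms to
   coatoms. *)
pose p0 i := odflt i [pick j | [exists x, (t x == Coatom i) && (t' (s x) == Coatom j)]].
have p0P x i : t x = Coatom i -> t' (s x) = Coatom (p0 i).
  move=> xi; have [j xj] := coatomP x i xi; rewrite /p0; case: pickP => [k|none].
    by case/existsP => y /andP[/eqP yi /eqP <-]; rewrite (kind_inj tD _ xi yi).
  by have /existsP[] := none j; exists x; rewrite xi xj !eqxx.
have coatom_ex i : exists x, t x = Coatom i by apply: (kind_exists tD).
have p0_inj : injective p0.
  move=> i j ij; have [[x xi] [y yj]] := (coatom_ex i, coatom_ex j).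
  have := p0P y j yj; rewrite -ij => yi.
  have /perm_inj xy := kind_inj tD' (leqnn 1 : mult _ (Coatom _) <= 1) (p0P x i xi) yi.
  by move: yj; rewrite -xy xi => -[].
pose p := perm p0_inj; exists p.
have st x : t' (s x) = relabel_kind p (t x).
  case xk: (t x) => [[]|[i|e]] /=.
  - by apply/eqP; rewrite top_iso xk.
  - by apply/eqP; rewrite bot_iso xk.
  - by rewrite (p0P x i xk) permE.
  have := coatom_iso x.
  rewrite (coatoms_graph c_gt0 dV tD) (coatoms_graph c_gt0 dV' tD') xk.
  have := top_iso x; have := bot_iso x; rewrite xk.
  case xf: (t' (s x)) => [[]|[|f]] // _ _ _; congr (Atom _); apply/setP => j.
  rewrite -(permKV p j) mem_imset; last exact: perm_inj.
  have [y yi] := coatom_ex (p^-1 j); have := lt_iso x y.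
  by rewrite xf (p0P y _ yi) yi xk /= -[p0 _]permE.
apply: config_eq => // [|k]; first by rewrite admissible_relabel.
rewrite -[k](relabel_kindKV p) mult_relabel -tD -tD' relabel_kindKV.
rewrite -[RHS](card_imset _ (@perm_inj _ s)); apply: eq_card => y.
rewrite -(permKV s y) mem_imset; last exact: perm_inj.
by rewrite !inE st -{1}[k](relabel_kindKV p) (inj_eq (can_inj (relabel_kindK p))).
Qed.

End Isomorphism.

(** * Every graded lattice of rank 3 comes from a configuration *)

Section Representation.

Variables (c a : nat) (T : finType) (r : {set T * T}).
Hypothesis c_gt0 : 0 < c.
Hypothesis rL : r \in rank3_lattices T c a.
Implicit Types (x y z w : T) (i j : 'I_c) (e f g : {set 'I_c}).

Local Notation le := (le_of r).
Local Notation lt := (lt_of r).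

Lemma lat_refl x : le x x.
Proof. by move: rL; rewrite inE => /and3P[/andP[/and3P[/forallP]]]. Qed.

Lemma lat_anti x y : le x y -> le y x -> x = y.
Proof.
move: rL; rewrite inE => /and3P[/andP[/and3P[_ /forallP/(_ x)/forallP/(_ y)]]].
by move=> /implyP H _ _ _ _ xy yx; apply/eqP/H; rewrite xy.
Qed.

Lemma lat_trans y x z : le x y -> le y z -> le x z.
Proof.
move: rL; rewrite inE => /and3P[/andP[/and3P[_ _ /forallP/(_ x)/forallP/(_ y)]]].
by move=> /forallP/(_ z)/implyP H _ _ _ xy yz; apply: H; rewrite xy.
Qed.

Lemma lt_le x y : lt x y -> le x y. Proof. by case/andP. Qed.

Lemma lt_irr : irreflexive lt. Proof. by move=> x; rewrite /lt_of eqxx. Qed.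

Lemma le_lt_trans y x z : le x y -> lt y z -> lt x z.
Proof.
move=> xy /andP[yz lyz]; rewrite /lt_of (lat_trans xy lyz) andbT.
by apply: contraNneq yz => xz; apply/eqP/lat_anti; rewrite // -xz.
Qed.

Lemma lt_le_trans y x z : lt x y -> le y z -> lt x z.
Proof.
move=> /andP[xy lxy] yz; rewrite /lt_of (lat_trans lxy yz) andbT.
by apply: contraNneq xy => xz; apply/eqP/lat_anti; rewrite // xz.
Qed.

Lemma lt_trans : transitive lt.
Proof. by move=> y x z xy /lt_le; exact: lt_le_trans. Qed.

Lemma lt_neq x y : lt x y -> x != y. Proof. by case/andP. Qed.

Lemma exists_meet x y :
  exists m, [/\ le m x, le m y & forall z, le z x -> le z y -> le z m].
Proof.
move: rL; rewrite inE => /and3P[/andP[_ /forallP/(_ x)/forallP/(_ y)/andP[]]].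
move=> /existsP[m /and3P[mx my /forallP mP]] _ _ _; exists m; split=> // z zx zy.
by have /implyP := mP z; apply; rewrite zx.
Qed.

Lemma exists_join x y :
  exists m, [/\ le x m, le y m & forall z, le x z -> le y z -> le m z].
Proof.
move: rL; rewrite inE => /and3P[/andP[_ /forallP/(_ x)/forallP/(_ y)/andP[_]]].
move=> /existsP[m /and3P[mx my /forallP mP]] _ _; exists m; split=> // z zx zy.
by have /implyP := mP z; apply; rewrite zx.
Qed.

Lemma card_lat_coatoms : #|coatoms r| = c.
Proof. by move: rL; rewrite inE => /and4P[_ _ /eqP]. Qed.

Lemma card_lat_atoms : #|atoms r| = a.
Proof. by move: rL; rewrite inE => /and4P[_ _ _ /eqP]. Qed.

Lemma coatom_lt x : x \in coatoms r -> exists2 p, is_top r p & lt x p.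
Proof. by rewrite inE => /existsP[p /and3P[pp xp _]]; exists p. Qed.

Lemma sorted_chain s : sorted lt s -> is_chain r [set x in s].
Proof.
move=> ss; apply/forall_inP => x; rewrite inE => xs; apply/forall_inP => y.
rewrite inE => ys; case: (ltngtP (index x s) (index y s)) => xy.
- by rewrite (lt_le (sorted_ltn_index lt_trans ss _ _ xs ys xy)).
- by rewrite (lt_le (sorted_ltn_index lt_trans ss _ _ ys xs xy)) orbT.
- by rewrite (@index_inj _ x s x y) ?lat_refl.
Qed.

Lemma chain_extend s : sorted lt s ->
  exists2 C, is_chain r C && (#|C| == 4) & {subset s <= C}.
Proof.
move=> /sorted_chain /maxset_exists[C Cmax sC]; exists C.
  have := rL; rewrite inE => /and4P[_ /forallP/(_ C)/implyP-> //].
  by case/maxsetP: Cmax => ->.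
by move=> x xs; apply: (subsetP sC); rewrite inE.
Qed.

Lemma chain_size s : sorted lt s -> size s <= 4.
Proof.
move=> ss; have [C /andP[_ /eqP <-] sC] := chain_extend ss.
rewrite -(card_uniqP (sorted_uniq lt_trans lt_irr ss)).
by apply: subset_leq_card; apply/subsetP.
Qed.

(** Take b with the fewest lower bounds. The meet of b and any y is below b and has no fewer lower
    bounds, so b itself is a lower bound of that meet. A coatom provides the inhabitant of T from
    which to minimize. *)
Lemma lat_bottom : exists b, is_bottom r b.
Proof.
have [p _] : exists p, p \in coatoms r.
  by apply/set0Pn; rewrite -card_gt0 card_lat_coatoms.
case: (arg_minnP (fun x => #|[set y | le y x]|) (isT : predT p)) => b _ bmin.
exists b; apply/forallP => y; have [m [mb my _]] := exists_meet b y.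
suff: b \in [set z | le z m] by rewrite inE => /lat_trans; apply.
suff -> : [set z | le z m] = [set z | le z b] by rewrite inE lat_refl.
apply/eqP; rewrite eqEcard bmin // andbT; apply/subsetP => z.
by rewrite !inE => /lat_trans; apply.
Qed.

Lemma chain_extend1 s : sorted lt s -> size s < 4 ->
  exists2 w, w \notin s & forall x, x \in s -> lt x w \/ lt w x.
Proof.
move=> ss s4; have [C /andP[/forall_inP Cch /eqP C4] sC] := chain_extend ss.
have [w wC ws] : exists2 w, w \in C & w \notin s.
  apply/exists_inP; rewrite -negb_forall_in; apply: contraL s4 => /forall_inP Cs.
  rewrite -leqNgt -C4; apply: leq_trans (card_size s).
  exact/subset_leq_card/subsetP.
exists w => // x xs; have xw : x != w by apply: contraNneq ws => <-.
have /forall_inP/(_ w wC)/orP[] := Cch x (sC x xs) => xw'; [left | right].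
  by rewrite /lt_of xw.
by rewrite /lt_of eq_sym xw.
Qed.

Section Levels.

Variables (b p : T).
Hypotheses (bb : is_bottom r b) (pp : is_top r p).

Lemma bot_le x : le b x. Proof. exact: (forallP bb). Qed.
Lemma le_top x : le x p. Proof. exact: (forallP pp). Qed.

Lemma bot_lt x : x != b -> lt b x.
Proof. by move=> xb; rewrite /lt_of eq_sym xb bot_le. Qed.

Lemma lt_top x : x != p -> lt x p.
Proof. by move=> xp; rewrite /lt_of xp le_top. Qed.

Lemma is_bottomE x : is_bottom r x -> x = b.
Proof. by move=> /forallP/(_ b) xb; apply: lat_anti => //; exact: bot_le. Qed.

Lemma is_topE x : is_top r x -> x = p.
Proof. by move=> /forallP/(_ p) xp; apply: lat_anti => //; exact: le_top. Qed.

Lemma no_five x y z : lt b x -> lt x y -> lt y z -> lt z p -> False.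
Proof.
move=> bx xy yz zp; have := @chain_size [:: b; x; y; z; p].
by rewrite /= bx xy yz zp => /(_ isT).
Qed.

Lemma in_coatoms x : (x \in coatoms r) = covers r x p.
Proof.
rewrite inE; apply/existsP/idP => [[q /andP[/is_topE->]]//|xp].
by exists p; rewrite pp.
Qed.

Lemma in_atoms x : (x \in atoms r) = covers r b x.
Proof.
rewrite inE; apply/existsP/idP => [[q /andP[/is_bottomE->]]//|xp].
by exists b; rewrite bb.
Qed.

Lemma bot_lt_top : lt b p.
Proof.
have [x] : exists x, x \in coatoms r.
  by apply/set0Pn; rewrite -card_gt0 card_lat_coatoms.
rewrite in_coatoms => /andP[xp _]; apply: le_lt_trans xp; exact: bot_le.
Qed.

Lemma coatom_above_bot x : x \in coatoms r -> lt b x.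
Proof.
move=> xco; apply: bot_lt; apply: contraTneq xco => ->.
rewrite in_coatoms /covers bot_lt_top negb_forall /=.
have [||w] := @chain_extend1 [:: b; p]; rewrite //= ?bot_lt_top //.
rewrite !inE negb_or => /andP[wb wp] _.
by apply/existsP; exists w; rewrite bot_lt ?lt_top.
Qed.

(** The remaining level, described without reference to atoms. That atoms and coatoms are disjoint
    is not known yet; it follows from [low_atoms]. *)
Definition low x := [&& x != b, x != p & x \notin coatoms r].

(** The chain b < x < p has only three elements, so it extends by some w. Nothing lies between the
    coatom x and the top, so w is below x, and x then shows that w is no coatom. *)
Lemma coatom_above_low x : x \in coatoms r -> exists2 w, low w & lt w x.
Proof.
move=> xco; have bx := coatom_above_bot xco.
move: (xco); rewrite in_coatoms => /andP[xp /forallP none].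
have [||w] := @chain_extend1 [:: b; x; p]; rewrite //= ?bx ?xp //.
rewrite !inE !negb_or => /and3P[wb wx wp] /(_ x); rewrite !inE eqxx orbT.
case=> [//|xw|wx']; first by have := none w; rewrite xw lt_top.
exists w => //; rewrite /low wb wp in_coatoms /covers negb_and negb_forall.
by apply/orP; right; apply/existsP; exists x; rewrite wx' xp.
Qed.

Lemma low_below_coatom x : low x -> exists2 w, w \in coatoms r & lt x w.
Proof.
move=> /and3P[xb xp]; rewrite in_coatoms /covers lt_top //= negb_forall.
case/existsP=> w; rewrite negbK => /andP[xw wp]; exists w => //.
rewrite in_coatoms /covers wp; apply/forallP => z; apply/negP => /andP[wz zp].
exact: (no_five (bot_lt xb) xw wz zp).
Qed.

Lemma low_antichain x y : low x -> low y -> ~~ lt x y.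
Proof.
move=> xl yl; have [w wco yw] := low_below_coatom yl; apply/negP => xy.
move: wco; rewrite in_coatoms => /andP[wp _]; case/and3P: xl => xb _ _.
exact: (no_five (bot_lt xb) xy yw wp).
Qed.

Lemma coatom_not_below x y : x \in coatoms r -> y != p -> ~~ lt x y.
Proof.
rewrite in_coatoms => /andP[_ /forallP/(_ y)] + yp.
by rewrite lt_top // andbT.
Qed.

Lemma low_atoms x : low x = (x \in atoms r).
Proof.
rewrite in_atoms; apply/idP/idP => [xl|/andP[bx /forallP none]].
  case/and3P: (xl) => xb xp _; rewrite /covers bot_lt //=.
  have [w] := low_below_coatom xl; rewrite in_coatoms => /andP[wp _] xw.
  apply/forallP => z; apply/negP => /andP[bz zx].
  exact: (no_five bz zx xw wp).
rewrite /low eq_sym (lt_neq bx) /=; apply/andP; split.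
  have [y yco] : exists y, y \in coatoms r.
    by apply/set0Pn; rewrite -card_gt0 card_lat_coatoms.
  apply: contraTneq isT => xp; have := none y.
  by rewrite coatom_above_bot //= xp; move: yco; rewrite in_coatoms => /andP[->].
apply/negP => /coatom_above_low[w /and3P[wb _ _] wx].
by have := none w; rewrite bot_lt // wx.
Qed.

(** If x and y differ, their join m is strictly above x, because low elements form an antichain. It
    lies below both z and w, hence strictly below one of them, and this gives a chain of five
    elements. *)
Lemma low_unique x y z w : low x -> low y -> z != w ->
    z \in coatoms r -> w \in coatoms r ->
  le x z -> le x w -> le y z -> le y w -> x = y.
Proof.
move=> xl yl zw zco wco xz xw yz yw; apply/eqP; apply: contraT => xy.
have [m [xm ym mP]] := exists_join x y.
have {}xm : lt x m.
  rewrite /lt_of xm andbT; apply: contraNneq (low_antichain yl xl) => xm'.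
  by rewrite /lt_of eq_sym xy xm'.
have xb : lt b x by case/and3P: xl => /bot_lt.
have [mz mw] := (mP z xz yz, mP w xw yw).
have top u : u \in coatoms r -> lt u p by rewrite in_coatoms => /andP[].
case: (eqVneq m z) => [mz'|mz'].
  by case: (no_five xb xm _ (top w wco)); rewrite /lt_of mw mz' zw.
by case: (no_five xb xm _ (top z zco)); rewrite /lt_of mz mz'.
Qed.

Definition coat (i : 'I_c) : T := enum_val (cast_ord (esym card_lat_coatoms) i).

Lemma coat_inj : injective coat.
Proof. by move=> i j /enum_val_inj/cast_ord_inj. Qed.

Lemma coat_in i : coat i \in coatoms r.
Proof. exact: enum_valP. Qed.

Lemma coat_surj x : x \in coatoms r -> exists i, coat i = x.
Proof.
move=> xco; exists (cast_ord card_lat_coatoms (enum_rank_in xco x)).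
by rewrite /coat cast_ordK enum_rankK_in.
Qed.

Definition kind_of x : kind c :=
  if x == b then Bot else if x == p then Top
  else if [pick i | coat i == x] is Some i then Coatom i
  else Atom [set i | le x (coat i)].

Lemma kind_of_bot : kind_of b = Bot. Proof. by rewrite /kind_of eqxx. Qed.

Lemma kind_of_top : kind_of p = Top.
Proof. by rewrite /kind_of eqxx eq_sym (negPf (lt_neq bot_lt_top)). Qed.

Lemma coat_mid i : coat i != b /\ coat i != p.
Proof.
rewrite eq_sym (lt_neq (coatom_above_bot (coat_in i))); split=> //.
by have := coat_in i; rewrite in_coatoms => /andP[/lt_neq].
Qed.

Lemma kind_of_coat i : kind_of (coat i) = Coatom i.
Proof.
have [ib ip] := coat_mid i; rewrite /kind_of (negPf ib) (negPf ip).
case: pickP => [j /eqP/coat_inj->//|/(_ i)]; by rewrite eqxx.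
Qed.

Lemma kind_of_low x : low x -> kind_of x = Atom [set i | le x (coat i)].
Proof.
case/and3P => xb xp xco; rewrite /kind_of (negPf xb) (negPf xp).
by case: pickP => // i /eqP ix; rewrite -ix coat_in in xco.
Qed.

Lemma kind_ofP x : [\/ x = b, x = p, exists i, x = coat i | low x].
Proof.
case: (eqVneq x b) => xb; first by constructor 1.
case: (eqVneq x p) => xp; first by constructor 2.
case: (boolP (x \in coatoms r)) => [/coat_surj[i <-]|xco].
  by constructor 3; exists i.
by constructor 4; rewrite /low xb xp.
Qed.

Lemma lt_kind_of x y : lt x y = below (kind_of x) (kind_of y).
Proof.
have bot z : lt z b = false.
  by apply/negP => /lt_le_trans/(_ (bot_le z)); rewrite lt_irr.
have top z : lt p z = false.
  by apply/negP => /(le_lt_trans (le_top z)); rewrite lt_irr.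
case: (kind_ofP x) => [->|->|[i ->]|xl].
- rewrite kind_of_bot; case: (kind_ofP y) => [->|->|[j ->]|yl].
  + by rewrite kind_of_bot lt_irr.
  + by rewrite kind_of_top bot_lt_top.
  + by rewrite kind_of_coat bot_lt //; case: (coat_mid j).
  + by rewrite kind_of_low // bot_lt //; case/and3P: yl.
- by rewrite top kind_of_top.
- rewrite kind_of_coat; case: (kind_ofP y) => [->|->|[j ->]|yl].
  + by rewrite kind_of_bot bot.
  + by rewrite kind_of_top lt_top //; case: (coat_mid i).
  + rewrite kind_of_coat; apply/negbTE/coatom_not_below; first exact: coat_in.
    by case: (coat_mid j).
  + rewrite kind_of_low //; apply/negbTE/coatom_not_below; first exact: coat_in.
    by case/and3P: yl.
rewrite (kind_of_low xl); case: (kind_ofP y) => [->|->|[j ->]|yl].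
- by rewrite kind_of_bot bot.
- by rewrite kind_of_top lt_top //; case/and3P: xl.
- rewrite kind_of_coat /= inE /lt_of; case: eqP => // xj.
  by case/and3P: xl => _ _; rewrite xj coat_in.
by rewrite (kind_of_low yl) (negPf (low_antichain xl yl)).
Qed.

Lemma graph_of_kind_of : r = graph_of kind_of.
Proof.
apply/setP => -[x y]; rewrite inE /= -lt_kind_of /lt_of.
by case: eqP => //= <-; exact: lat_refl.
Qed.

Lemma kind_of_atom x e : kind_of x = Atom e ->
  low x /\ e = [set i | le x (coat i)].
Proof.
case: (kind_ofP x) => [->|->|[i ->]|xl].
- by rewrite kind_of_bot.
- by rewrite kind_of_top.
- by rewrite kind_of_coat.
by rewrite kind_of_low // => -[].
Qed.

(** [inord] preserves the count here, since by [card_atom_kind] no kind has more than a atoms. *)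
Definition lattice_config : config c a :=
  ([set e : {set 'I_c} | (1 < #|e|) && [exists x, kind_of x == Atom e]],
   [ffun i => inord #|[set x | kind_of x == Atom [set i]]|]).

Lemma card_atom_kind e : #|[set x | kind_of x == Atom e]| <= a.
Proof.
rewrite -card_lat_atoms; apply/subset_leq_card/subsetP => x; rewrite inE.
by move=> /eqP/kind_of_atom[]; rewrite low_atoms.
Qed.

Lemma atom_kind_inj x y e : 1 < #|e| ->
  kind_of x = Atom e -> kind_of y = Atom e -> x = y.
Proof.
case/card_gt1P => i [j [ie je ij]] /kind_of_atom[xl xe] /kind_of_atom[yl ye].
apply: (@low_unique x y (coat i) (coat j)) => //; rewrite ?coat_in //.
- by rewrite (inj_eq coat_inj).
- by move: ie; rewrite xe inE.
- by move: je; rewrite xe inE.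
- by move: ie; rewrite ye inE.
- by move: je; rewrite ye inE.
Qed.

Lemma kind_of_fiber k : #|[set x | kind_of x == k]| = mult lattice_config k.
Proof.
have fiber1 z l : kind_of z = l -> (forall x, kind_of x = l -> x = z) ->
    #|[set x | kind_of x == l]| = 1.
  move=> zl H; rewrite -(cards1 z); apply: eq_card => x; rewrite !inE.
  by apply/eqP/eqP => [/H|->].
case: k => [[]|[i|e]].
- apply: fiber1 kind_of_top _ => x; case: (kind_ofP x) => [->|->|[i ->]|xl] //.
  + by rewrite kind_of_bot.
  + by rewrite kind_of_coat.
  + by rewrite kind_of_low.
- apply: fiber1 kind_of_bot _ => x; case: (kind_ofP x) => [->|->|[i ->]|xl] //.
  + by rewrite kind_of_top.
  + by rewrite kind_of_coat.
  + by rewrite kind_of_low.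
- apply: fiber1 (kind_of_coat i) _ => x; case: (kind_ofP x) => [->|->|[j ->]|xl].
  + by rewrite kind_of_bot.
  + by rewrite kind_of_top.
  + by rewrite kind_of_coat => -[->].
  + by rewrite kind_of_low.
(* An atom lies under some coatom, which excludes size 0; size at least 2 allows one atom by
   [atom_kind_inj]; for singletons the weight is the fibre size by definition. *)
rewrite /mult /= inE; case: (ltngtP #|e| 1) => e1 /=.
- have ->: e = set0 by apply/eqP; rewrite -cards_eq0; case: #|e| e1.
  rewrite big_pred0 => [|i]; last by apply/negP => /eqP/setP/(_ i); rewrite !inE eqxx.
  apply/eqP; rewrite cards_eq0; apply/eqP/setP => x; rewrite !inE.
  apply/negP => /eqP/kind_of_atom[/low_below_coatom[w /coat_surj[i <-] /lt_le xi]].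
  by move=> /setP/(_ i); rewrite !inE xi.
- rewrite big_pred0 ?addn0 => [|i]; last by apply/negP => /eqP ei; rewrite ei cards1 in e1.
  case: existsP => [[x /eqP xe]|none].
    by apply: (fiber1 x) => // y ye; exact: (atom_kind_inj e1 ye xe).
  apply/eqP; rewrite cards_eq0; apply/eqP/setP => x; rewrite !inE.
  by apply/negP => xe; apply: none; exists x.
move/eqP: e1 => /cards1P[i ->]; rewrite (big_pred1 i) => [|j]; last first.
  by rewrite (inj_eq set1_inj) eq_sym.
by rewrite ffunE inordK // ltnS card_atom_kind.
Qed.

Lemma admissible_lattice_config : admissible lattice_config.
Proof.
apply/and3P; split.
- apply/andP; split; apply/forall_inP => e; rewrite inE => /andP[e1 /existsP[x /eqP xe]] //.
  apply/forall_inP => f; rewrite inE => /andP[f1 /existsP[y /eqP ye]].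
  apply/implyP; apply: contraNT; rewrite -ltnNge => /card_gt1P[i [j [iI jI ij]]].
  have [[xl xE] [yl yE]] := (kind_of_atom xe, kind_of_atom ye).
  suff xy : x = y by rewrite xE yE xy.
  move: iI jI; rewrite !inE xE yE !inE => /andP[xi yi] /andP[xj yj].
  apply: (@low_unique x y (coat i) (coat j)); rewrite ?coat_in //.
  by rewrite (inj_eq coat_inj).
- apply/forallP => i; apply/implyP => icov; rewrite ffunE inordK ?ltnS ?card_atom_kind //.
  have [w wl wi] := coatom_above_low (coat_in i).
  apply/card_gt0P; exists w; rewrite inE kind_of_low //.
  apply: contraNT icov => we; apply/bigcupP; exists [set j | le w (coat j)].
    rewrite inE; apply/andP; split; last by apply/existsP; exists w; rewrite kind_of_low.
    rewrite ltnNge; apply: contraNN we => w1; apply/eqP; congr (Atom _).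
    apply/eqP; rewrite eq_sym eqEcard cards1 w1 sub1set inE (lt_le wi) //.
  by rewrite inE (lt_le wi).
rewrite -sum_atom_mult -[X in _ == X]card_lat_atoms.
have ->: atoms r = [set x | if kind_of x is Atom _ then true else false].
  apply/setP => x; rewrite -low_atoms inE; apply/idP/idP => [/kind_of_low->//|].
  by case xe: (kind_of x) => [|[|e]] // _; case/kind_of_atom: xe.
by rewrite card_atom_kinds; apply/eqP; apply: eq_bigr => e _; rewrite kind_of_fiber.
Qed.

End Levels.

Lemma lattice_representation : exists (t : T -> kind c) (d : config c a),
  [/\ admissible d, forall k, #|[set x | t x == k]| = mult d k & r = graph_of t].
Proof.
have [b bb] := lat_bottom.
have [x xco] : exists x, x \in coatoms r.
  by apply/set0Pn; rewrite -card_gt0 card_lat_coatoms.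
have [p pp _] := coatom_lt xco.
exists (kind_of b p), (lattice_config b p); split.
- exact: admissible_lattice_config.
- exact: kind_of_fiber.
exact: graph_of_kind_of.
Qed.

End Representation.

(** The labeling is a finite function so that the existence statement is boolean and [pick] can
    choose a configuration in [R_orbits]. *)
Definition encodes c a (T : finType) (d : config c a) (r : {set T * T}) : bool :=
  admissible d && [exists t : {ffun T -> kind c},
    [forall k, #|[set x | t x == k]| == mult d k] && (r == graph_of t)].

Lemma encodesP c a (T : finType) (d : config c a) (r : {set T * T}) :
  reflect (exists t : T -> kind c, [/\ admissible d,
             forall k, #|[set x | t x == k]| = mult d k & r = graph_of t])
          (encodes d r).
Proof.
apply: (iffP andP) => [[dV /existsP[t /andP[/forallP tD /eqP rt]]]|[t [dV tD rt]]].
  by exists t; split=> // k; apply/eqP.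
split=> //; apply/existsP; exists (finfun t); apply/andP; split.
  by apply/forallP => k; rewrite -tD; apply/eqP/eq_card => x; rewrite !inE ffunE.
by rewrite rt; apply/eqP/setP => -[x y]; rewrite !inE !ffunE.
Qed.

Lemma R_orbits c a : 0 < c ->
  R c a = #|orbit (@relabel_action c a) [set: {perm 'I_c}] @: [set d | admissible d]|.
Proof.
move=> c_gt0; set to := relabel_action c a; set G := [set: {perm 'I_c}].
(* Only a default for [odflt]: by [repP] the pick succeeds on every lattice. *)
pose d0 : config c a := (set0, [ffun=> ord0]).
pose rep (r : {set 'I_(c + a + 2) * 'I_(c + a + 2)}) := odflt d0 [pick d | encodes d r].
have repP r : r \in rank3_lattices 'I_(c + a + 2) c a -> encodes (rep r) r.
  move=> rL; rewrite /rep; case: pickP => // none.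
  have [t [d H]] := lattice_representation c_gt0 rL.
  by have /encodesP[] := none d; exists t.
have same (r r' : {set 'I_(c + a + 2) * 'I_(c + a + 2)}) d d' :
    encodes d r -> encodes d' r' ->
    isomorphic r r' = (orbit to G d == orbit to G d').
  case/encodesP => t [dV tD ->] /encodesP[t' [dV' tD' ->]].
  rewrite orbit_eq_mem orbit_sym; apply/idP/orbitP => [|[p _ dp]].
    by case/(isomorphic_relabel c_gt0 dV dV' tD tD') => p ->; exists p.
  exact: (relabel_isomorphic tD tD' (esym dp)).
rewrite /R (@card_equivalence_partition_image _ _ _ _ (fun r => orbit to G (rep r))).
  congr #|pred_of_set _|; apply/setP => B; apply/imsetP/imsetP => -[].
    by move=> r /repP/andP[dV _] ->; exists (rep r); rewrite ?inE.
  move=> d; rewrite inE => dV ->.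
  (* Every orbit is reached because the multiplicities add up to c + a + 2, the size of the
     carrier. *)
  have [|t tD] := @exists_fibers (c + a + 2) (kind c) (mult d).
    rewrite big_sumType /= big_bool /= big_sumType /= sum1_card card_ord.
    rewrite sum_atom_mult; case/and3P: dV => _ _ /eqP->.
    by rewrite addnC.
  have rL := graph_rank3 c_gt0 dV tD; exists (graph_of t) => //; apply/eqP.
  rewrite -(same (graph_of t) (graph_of t)) ?repP //; last first.
    by apply/encodesP; exists t.
  apply/existsP; exists 1%g; apply/forallP => x; apply/forallP => y.
  by rewrite !perm1.
by move=> r r' rL rL'; apply: same; exact: repP.
Qed.

Lemma R_fixed_points c a : 0 < c ->
  R c a * c`! =
  \sum_(p : {perm 'I_c}) #|[set d : config c a | admissible d & relabel d p == d]|.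
Proof.
move=> c_gt0; rewrite R_orbits // -card_Sn -cardsT.
rewrite -(@Frobenius_Cauchy _ [set: {perm 'I_c}]%G _ (relabel_action c a)).
  apply: eq_big => [p|p _]; first by rewrite inE.
  by apply: eq_card => d; rewrite !inE sub1set inE.
apply/actsP => p _ d; rewrite !inE; exact: admissible_relabel.
Qed.

(** * Counting the configurations fixed by a permutation *)

(** Sylvester's denumerant: j is the number of parts d taken from the head of l. For positive d the
    bound j <= s loses nothing. *)
Fixpoint denumerant (l : seq nat) (s : nat) : nat :=
  if l is d :: l' then \sum_(j < s.+1 | j * d <= s) denumerant l' (s - j * d)
  else s == 0.

(** Either the part d does not occur, or one copy of it can be removed. *)
Lemma denumerant_rec d l s : 0 < d ->
  denumerant (d :: l) s =
  denumerant l s + (if d <= s then denumerant (d :: l) (s - d) else 0).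
Proof.
move=> d_gt0; rewrite /= big_mkcond big_ord_recl /= mul0n subn0; congr (_ + _).
rewrite -big_mkcond /=; case: leqP => ds; last first.
  by apply: big_pred0 => j; rewrite /bump /=; apply/negbTE; nia.
have sds : (s - d).+1 <= s by lia.
rewrite (big_ord_widen_cond _ (fun j => j * d <= s - d)
  (fun j => denumerant l (s - d - j * d)) sds).
apply: eq_big => [j|j _]; rewrite /bump /=; last by congr denumerant; nia.
by apply/idP/andP => [|[]]; [split|]; nia.
Qed.

(** * Weight functions invariant under a permutation *)

Section Weights.

Variables (I : finType) (a : nat) (p : {perm I}).
Implicit Types (m : {ffun I -> 'I_a.+1}) (Z C : {set I}) (i j : I).

(** The weights vanish on Z and are positive on C. Both constraints are carried along so that the
    two cases of [denumerant_rec] can be reproduced one cycle at a time. *)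
Definition weights Z C s : {set {ffun I -> 'I_a.+1}} :=
  [set m : {ffun I -> 'I_a.+1} |
    [&& [forall i, m (p i) == m i], [forall i in Z, m i == 0 :> nat],
               [forall i in C, 0 < m i] & \sum_i m i == s]].

Lemma weightsP Z C s m :
  reflect [/\ forall i, m (p i) = m i, forall i, i \in Z -> m i = 0 :> nat,
              forall i, i \in C -> 0 < m i & \sum_i m i = s]
          (m \in weights Z C s).
Proof.
rewrite inE; apply: (iffP and4P) => -[].
  move=> /forallP ip /forall_inP iZ /forall_inP iC /eqP ms; split=> // i.
    exact/eqP.
  by move/iZ/eqP.
move=> ip iZ iC ms; split; last exact/eqP.
- by apply/forallP => i; rewrite ip.
- by apply/forall_inP => i /iZ/eqP.
by apply/forall_inP.
Qed.

Lemma weights_le Z C s m i : m \in weights Z C s -> m i <= s.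
Proof. by case/weightsP => _ _ _ <-; rewrite (bigD1 i) //= leq_addr. Qed.

(** Subtracting 1 on C is a bijection; it respects invariance because p preserves C. As s <= a,
    adding 1 back stays within 'I_a.+1. *)
Lemma card_weights_shift Z C s : s <= a -> {in C, forall i, i \notin Z} ->
    (forall i, (p i \in C) = (i \in C)) ->
  #|weights Z C s| = if #|C| <= s then #|weights Z set0 (s - #|C|)| else 0.
Proof.
move=> sa CZ pC; have sumC : \sum_i (i \in C : nat) = #|C|.
  by rewrite -sum1_card [RHS]big_mkcond; apply: eq_bigr => i _; case: (_ \in _).
case: leqP => Cs; last first.
  apply/eqP; rewrite cards_eq0; apply/eqP/setP => m; rewrite [RHS]inE.
  apply/negP => /weightsP[_ _ mC ms]; move: Cs; rewrite -ms -sumC ltnNge => /negP[].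
  by apply: leq_sum => i _; case: (boolP (_ \in _)) => // /mC.
pose f m : {ffun I -> 'I_a.+1} := [ffun i => inord (m i + (i \in C))].
have fE m i : m \in weights Z set0 (s - #|C|) -> f m i = m i + (i \in C) :> nat.
  move=> /(weights_le i) mi; rewrite ffunE inordK //.
  case: (boolP (i \in C)) => [iC|_]; last by lia.
  by have : 0 < #|C| by [apply/card_gt0P; exists i]; lia.
have -> : weights Z C s = f @: weights Z set0 (s - #|C|).
  apply/setP => m; apply/idP/imsetP => [mW|[m' m'W ->]]; last first.
    have /weightsP[mp mZ _ ms] := m'W; apply/weightsP; split=> [i|i iZ|i iC|].
    - by rewrite !ffunE mp pC.
    - rewrite fE // mZ //; case: (boolP (_ \in _)) => // /CZ.
      by rewrite iZ.
    - by rewrite fE // iC addn1.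
    under eq_bigr do rewrite fE //.
    by rewrite big_split /= ms sumC subnK.
  have /weightsP[mp mZ mC ms] := mW.
  pose m' : {ffun I -> 'I_a.+1} := [ffun i => inord (m i - (i \in C))].
  have m'E i : m' i = m i - (i \in C) :> nat.
    by rewrite ffunE inordK //; have := ltn_ord (m i); lia.
  have m'W : m' \in weights Z set0 (s - #|C|).
    apply/weightsP; split=> [i|i iZ|i|]; rewrite ?inE //.
    - by rewrite !ffunE mp pC.
    - by rewrite m'E mZ.
    under eq_bigr do rewrite m'E.
    rewrite sumnB; first by rewrite ms sumC.
    by move=> i _; case: (boolP (_ \in _)) => // /mC.
  exists m' => //; apply/ffunP => i; apply: val_inj; rewrite /= fE // m'E subnK //.
  by case: (boolP (_ \in _)) => // /mC.
rewrite card_in_imset // => m m' mW m'W mm'; apply/ffunP => i; apply: val_inj.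
have : f m i = f m' i :> nat by rewrite mm'.
by rewrite !fE // => /addIn.
Qed.

(** An invariant m is constant on C, so it is either zero on all of C or positive on all of C. *)
Lemma card_weights_split Z C s i0 : i0 \in C ->
    (forall m, (forall i, m (p i) = m i) -> {in C, forall i, m i = m i0}) ->
  #|weights Z set0 s| = #|weights (Z :|: C) set0 s| + #|weights Z C s|.
Proof.
move=> i0C Cconst; rewrite -(cardsID [set m : {ffun I -> 'I_a.+1} | m i0 == 0 :> nat]).
congr (_ + _); apply: eq_card => m; rewrite !inE.
  apply/andP/and4P => [[/and4P[mp /forall_inP mZ _ ms] /eqP m0]|[mp /forall_inP mZC _ ms]].
    split=> //; last by apply/forall_inP => i; rewrite inE.
    apply/forall_inP => i; rewrite inE => /orP[/mZ//|iC].
    by rewrite (Cconst m) ?m0 // => j; apply/eqP/(forallP mp).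
  split; last by apply: mZC; rewrite inE i0C orbT.
  apply/and4P; split=> //; apply/forall_inP => i; last by rewrite inE.
  by move=> iZ; apply: mZC; rewrite inE iZ.
apply/andP/and4P => [[m0 /and4P[mp mZ _ ms]]|[mp mZ /forall_inP mC ms]].
  split=> //; apply/forall_inP => i iC.
  by rewrite (Cconst m) ?lt0n // => j; apply/eqP/(forallP mp).
rewrite -lt0n mC //; split=> //; apply/and4P; split=> //.
by apply/forall_inP => i; rewrite inE.
Qed.

Lemma card_weights_setT s : #|weights setT set0 s| = (s == 0).
Proof.
case: eqP => [->|s0] /=.
  rewrite -[RHS](cards1 ([ffun=> ord0] : {ffun I -> 'I_a.+1})).
  apply: eq_card => m; rewrite [RHS]inE.
  apply/weightsP/eqP => [[_ m0 _ _]|->].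
    by apply/ffunP => i; apply: val_inj; rewrite ffunE /= m0 ?inE.
  split=> [i|i _|i|]; rewrite ?ffunE ?inE //.
  by rewrite big1 // => i _; rewrite ffunE.
apply/eqP; rewrite cards_eq0; apply/eqP/setP => m; rewrite [RHS]inE.
apply/negP => /weightsP[_ m0 _ ms]; apply: s0; rewrite -ms big1 // => i _.
by rewrite m0 ?inE.
Qed.

Lemma fcycle_const (m : I -> 'I_a.+1) c i j : (forall i, m (p i) = m i) ->
  fcycle p c -> i \in c -> j \in c -> m i = m j.
Proof.
move=> mp cyc ic jc.
have /iter_findex <- : fconnect p i j by rewrite (fconnect_cycle cyc ic).
by elim: (findex p i j) => //= k ->.
Qed.

(** This follows [denumerant_rec]: if the weight is zero on the first cycle c, the cycle joins the
    vanishing set; if it is positive, subtracting 1 along c lowers the total by [size c]. Hence an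
    induction on the cycles and, inside it, one on s. *)
Lemma card_weights s cs : s <= a -> all (fcycle p) cs -> [::] \notin cs ->
    uniq (flatten cs) ->
  #|weights [set i | i \notin flatten cs] set0 s| = denumerant (map size cs) s.
Proof.
elim: cs s => [|c cs IH] s sa.
  by move=> _ _ _; rewrite /= -card_weights_setT; congr #|pred_of_set (weights _ _ _)|.
case/andP=> cyc cycs; rewrite inE negb_or => /andP[c0 cs0].
rewrite [flatten (c :: cs)]/= map_cons.
rewrite cat_uniq => /and3P[cu disj csu].
have pc i : (p i \in [set x in c]) = (i \in [set x in c]).
  rewrite !inE; apply/idP/idP => ic; last first.
    by rewrite -(fconnect_cycle cyc ic) fconnect1.
  by rewrite -(fconnect_cycle cyc ic) fconnect_sym ?fconnect1 //; exact: perm_inj.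
have card_c : #|[set x in c]| = size c by rewrite cardsE; apply/card_uniqP.
have c_gt0 : 0 < size c by case: (c) c0.
elim/ltn_ind: s sa => s IHs sa.
have [i0 i0c] : exists i, i \in c by case: (c) c0 => // i c' _; exists i; exact: mem_head.
set Z := [set i | _]; rewrite (@card_weights_split Z [set i in c] s i0) ?inE //; last first.
  by move=> m mp i; rewrite inE => ic; apply: fcycle_const mp cyc ic i0c.
rewrite denumerant_rec //; congr (_ + _).
  rewrite -IH //; congr #|pred_of_set (weights _ _ _)|; apply/setP => i.
  rewrite !inE mem_cat negb_or; case: (boolP (i \in c)) => /= ic; rewrite ?orbT ?orbF //.
  by apply/esym; apply: contra disj => ics; apply/hasP; exists i.
rewrite card_weights_shift ?card_c //; last first.
  by move=> i; rewrite !inE mem_cat => ->.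
by case: leqP => // cs_s; rewrite IHs //; lia.
Qed.

End Weights.

(** The guard is needed because truncated subtraction would replace a negative argument by 0, where
    the denumerant is 1. *)
Definition shifted_denumerant (a : nat) (l : seq nat) (k : nat) : nat :=
  if k <= a then denumerant l (a - k) else 0.

(** For fixed H, admissibility asks m to be positive exactly on the complement of the cover, which p
    preserves because it fixes H. So [card_weights_shift] applies with that set as C. *)
Lemma card_fixed_configs c a (p : {perm 'I_c}) (cs : seq (seq 'I_c)) :
    all (fcycle p) cs -> [::] \notin cs -> perm_eq (flatten cs) (enum 'I_c) ->
  #|[set d : config c a | admissible d & relabel d p == d]| =
  \sum_(H | linear_space H && ([set p @: (e : {set _}) | e in H] == H))
     shifted_denumerant a (map size cs) (#|H| + #|~: cover H|).
Proof.
move=> cyc cs0 csT; have csu : uniq (flatten cs).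
  by rewrite (perm_uniq csT) enum_uniq.
have csn : [set i | i \notin flatten cs] = set0.
  by apply/setP => i; rewrite !inE (perm_mem csT) mem_enum.
rewrite -sum1dep_card.
rewrite (eq_bigl (fun d : config c a => (linear_space d.1 &&
    ([set p @: (e : {set _}) | e in d.1] == d.1)) &&
    ((#|d.1| <= a) && (d.2 \in weights a p set0 (~: cover d.1) (a - #|d.1|))))); last first.
  case=> H m; rewrite /admissible /= /relabel xpair_eqE /=.
  case: (linear_space H) => //=; case: (_ == H); rewrite ?andbF //= .
  case: (leqP #|H| a) => Ha /=; last first.
    by rewrite gtn_eqF ?ltn_addr // andbF.
  apply/andP/weightsP => [[/andP[/forallP cov /eqP ma] /eqP/ffunP mp]|[mp _ cov ma]].
    split=> [i||i|]; rewrite ?inE //.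
    - by have := mp (p i); rewrite ffunE permK.
    - by move=> i; rewrite inE.
    - by apply/implyP.
    - by rewrite -(addKn #|H| (\sum_i m i)); congr (_ - _).
  split; first (apply/andP; split); last 1 first.
  - by apply/eqP/ffunP => i; rewrite ffunE -mp permKV.
  - by apply/forallP => i; apply/implyP => icov; apply: cov; rewrite inE.
  - by rewrite ma subnKC.
rewrite -(pair_big_dep
  (fun H => linear_space H && ([set p @: (e : {set _}) | e in H] == H))
  (fun H (m : {ffun 'I_c -> 'I_a.+1}) =>
     (#|H| <= a) && (m \in weights a p set0 (~: cover H) (a - #|H|)))
  (fun _ _ => 1)) /=.
apply: eq_bigr => H /andP[_ /eqP pH]; rewrite /shifted_denumerant.
case: (leqP #|H| a) => Ha; last by rewrite big_pred0 // ifN // -ltnNge ltn_addr.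
rewrite sum1_card card_weights_shift ?leq_subr //; first last.
- move=> i; rewrite !inE; congr (~~ _); rewrite -{1}pH.
  apply/bigcupP/bigcupP => [[_ /imsetP[e eH ->]]|[e eH ie]].
    by rewrite mem_imset; [exists e | exact: perm_inj].
  exists (p @: e); first exact: imset_f.
  exact: imset_f.
- by move=> i _; rewrite inE.
have -> : (#|~: cover H| <= a - #|H|) = (#|H| + #|~: cover H| <= a).
  by rewrite leq_subRL.
have := card_weights (leq_trans (leq_subr _ _) (leq_subr #|H| a)) cyc cs0 csu.
by rewrite csn => ->; rewrite subnDA.
Qed.

(** * Enumeration of linear spaces by lists *)

(** Only cliques are ever extended. For n = 5 there are 26 possible lines, and filtering all of
    their 2^26 subsets would be out of reach. *)
Fixpoint cliques (X : Type) (e : rel X) (s : seq X) : seq (seq X) :=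
  if s is x :: s' then
    let r := cliques e s' in r ++ [seq x :: q | q <- r & all (e x) q]
  else [:: [::]].

Definition lines n := [seq s <- cliques (fun _ _ => true) (iota 0 n) | 1 < size s].

Definition almost_disjoint (s1 s2 : seq nat) := size [seq x <- s1 | x \in s2] <= 1.

Definition linear_spaces n := cliques almost_disjoint (lines n).

(** Filtering [iota] sorts the image, so that equality of lines is equality of lists. *)
Definition permute n (l s : seq nat) :=
  [seq y <- iota 0 n | y \in [seq nth 0 l x | x <- s]].

(** One inclusion suffices: relabeling is injective, so the image of q has as many lines as q. *)
Definition stable n l (q : seq (seq nat)) := all (fun s => permute n l s \in q) q.

Definition isolated n (q : seq (seq nat)) :=
  [seq x <- iota 0 n | ~~ has (fun s => x \in s) q].

Section Cliques.

Variables (X : eqType) (e : rel X).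
Implicit Types (x : X) (s q : seq X).

Lemma mem_cliques s q : uniq s ->
  (q \in cliques e s) = subseq q s && pairwise e q.
Proof.
elim: s q => [|x s IH] q /=; first by case: q.
case/andP=> xs us; rewrite mem_cat IH //; case: q => [|y q]; first by rewrite !sub0seq.
rewrite [RHS]/=; case: (eqVneq y x) => [->|yx]; last first.
  rewrite orbC; case: mapP => // -[q' _ [yx']].
  by rewrite yx' eqxx in yx.
rewrite mem_map => [|? ? []//]; rewrite mem_filter IH //.
case: (boolP (subseq (x :: q) s)) => [/mem_subseq/(_ x)|_] /=.
  by rewrite inE eqxx (negPf xs) => /(_ isT).
by rewrite andbCA.
Qed.

Lemma cliques_uniq s : uniq s -> uniq (cliques e s).
Proof.
elim: s => //= x s IH /andP[xs us]; rewrite cat_uniq IH //=; apply/andP; split.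
  apply/hasPn => _ /mapP[q _ ->]; rewrite mem_cliques // negb_and.
  apply/orP; left; apply: contra xs => /mem_subseq; apply.
  by rewrite inE eqxx.
by rewrite map_inj_uniq ?filter_uniq ?IH // => ? ? [].
Qed.

Definition decode (Y : finType) (f : X -> Y) q : {set Y} := [set y in map f q].

Lemma mem_decode (Y : finType) (f : X -> Y) s q x : {in s &, injective f} ->
  {subset q <= s} -> x \in s -> (f x \in decode f q) = (x \in q).
Proof.
move=> fI qs xs; rewrite inE; apply/mapP/idP => [[y yq /fI->//]|xq]; last by exists x.
exact: qs.
Qed.

Lemma decode_inj (Y : finType) (f : X -> Y) s : uniq s -> {in s &, injective f} ->
  {in [pred q | subseq q s] &, injective (decode f)}.
Proof.
move=> us fI q q'; rewrite !inE => qs qs' qq'.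
rewrite (subseq_uniqP us qs) (subseq_uniqP us qs'); apply: eq_in_filter => x xs /=.
by rewrite -(mem_decode fI (mem_subseq qs) xs) qq' (mem_decode fI (mem_subseq qs')).
Qed.

(** Since s has no duplicates and f is injective on it, each set satisfying P is decoded from
    exactly one subsequence of s. *)
Lemma big_cliques (Y : finType) (f : X -> Y) s (P : pred {set Y}) (F : {set Y} -> nat) :
    uniq s -> {in s &, injective f} ->
    (forall q, subseq q s -> P (decode f q) = pairwise e q) ->
    (forall A, P A -> exists2 q, subseq q s & A = decode f q) ->
  \sum_(A | P A) F A = \sum_(q <- cliques e s) F (decode f q).
Proof.
move=> us fI Pq Pex; rewrite -(big_map (decode f) predT F) -big_filter.
apply: perm_big; apply: uniq_perm; first by rewrite filter_uniq // index_enum_uniq.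
  rewrite map_inj_in_uniq ?cliques_uniq // => q q'; rewrite !mem_cliques //.
  by case/andP=> qs _ /andP[qs' _]; apply: (decode_inj us fI).
move=> A; rewrite mem_filter mem_index_enum andbT; apply/idP/mapP => [PA|[q]].
  have [q qs AE] := Pex A PA; exists q => //.
  by rewrite mem_cliques // qs -Pq -?AE.
by rewrite mem_cliques // => /andP[qs pq] ->; rewrite Pq.
Qed.

End Cliques.

(** * Lines and linear spaces as lists *)

Section ListModel.

Variable n : nat.
Local Notation N := n.+1.
Local Notation points := (iota 0 N).
Implicit Types (s : seq nat) (q : seq (seq nat)) (i j : 'I_N) (p : {perm 'I_N}).

Definition line_set s : {set 'I_N} := decode inord s.

Lemma inord_inj : {in points &, injective (@inord n)}.
Proof.
move=> x y; rewrite !mem_iota /= !add0n => xn yn /(congr1 val).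
by rewrite /= !inordK.
Qed.

Lemma mem_line_set s i : {subset s <= points} -> (i \in line_set s) = (val i \in s).
Proof.
move=> ss; rewrite -{1}[i]inord_val (mem_decode inord_inj ss) //.
by rewrite mem_iota /= add0n.
Qed.

Lemma card_line_set s : subseq s points -> #|line_set s| = size s.
Proof.
move=> ss; rewrite -(size_map (@inord n)) cardsE; apply/card_uniqP.
rewrite map_inj_in_uniq; first by rewrite (subseq_uniq ss) ?iota_uniq.
by move=> x y /(mem_subseq ss) xs /(mem_subseq ss) ys; apply: inord_inj.
Qed.

Lemma line_set_val (e : {set 'I_N}) :
  subseq [seq val i | i <- enum e] points /\ line_set [seq val i | i <- enum e] = e.
Proof.
have ss : subseq [seq val i | i <- enum e] points.
  rewrite -val_enum_ord; apply: map_subseq; rewrite enumT; exact: filter_subseq.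
split=> //; apply/setP => i; rewrite mem_line_set; last exact: mem_subseq.
by rewrite mem_map ?mem_enum //; exact: val_inj.
Qed.

Lemma line_set_inj : {in [pred s | subseq s points] &, injective line_set}.
Proof. exact: decode_inj (iota_uniq _ _) inord_inj. Qed.

Lemma almost_disjointE s1 s2 : subseq s1 points -> subseq s2 points ->
  almost_disjoint s1 s2 = (#|line_set s1 :&: line_set s2| <= 1).
Proof.
move=> ss1 ss2; rewrite /almost_disjoint -card_line_set; last first.
  exact: subseq_trans (filter_subseq _ _) ss1.
congr (_ <= _); apply: eq_card => i.
rewrite in_setI !mem_line_set ?mem_filter 1?andbC //; try exact: mem_subseq.
by move=> x; rewrite mem_filter => /andP[_ /(mem_subseq ss1)].
Qed.

Lemma mem_lines s : (s \in lines N) = (1 < size s) && subseq s points.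
Proof.
rewrite mem_filter mem_cliques ?iota_uniq //.
suff -> : pairwise (fun _ _ => true) s by rewrite andbT.
by elim: s => //= x s ->; rewrite andbT; apply/allP.
Qed.

Lemma lines_uniq : uniq (lines N).
Proof. by rewrite filter_uniq // cliques_uniq ?iota_uniq. Qed.

Lemma line_set_lines_inj : {in lines N &, injective line_set}.
Proof.
move=> s s'; rewrite !mem_lines => /andP[_ ss] /andP[_ ss'].
exact: line_set_inj.
Qed.

Definition space_of q : {set {set 'I_N}} := decode line_set q.

(** [pairwise] compares entries only in their order in q; the converse direction sorts two lines by
    index and uses symmetry of [almost_disjoint]. Distinctness of the lines comes from q having no
    duplicates. *)
Lemma linear_space_of q : subseq q (lines N) ->
  linear_space (space_of q) = pairwise almost_disjoint q.
Proof.
move=> qs; have ql s : s \in q -> (1 < size s) /\ subseq s points.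
  by move=> /(mem_subseq qs); rewrite mem_lines => /andP[].
have -> : linear_space (space_of q) = [forall e in space_of q, forall f in space_of q,
    (e != f) ==> (#|e :&: f| <= 1)].
  apply: andb_idl => _; apply/forall_inP => e; rewrite inE => /mapP[s /ql[s1 ss] ->].
  by rewrite card_line_set.
apply/forall_inP/idP => [H|pq e].
  have : pairwise (fun s s' => s != s') q.
    by rewrite -uniq_pairwise (subseq_uniq qs) ?lines_uniq.
  apply: (sub_in_pairwise (P := mem q)); last exact/allP.
  move=> s s' sq sq' ss'.
  have /forall_inP/(_ (line_set s')) : [forall f in space_of q, (line_set s != f) ==>
    (#|line_set s :&: f| <= 1)] by apply: H; rewrite inE map_f.
  have [[_ ss] [_ ss2]] := (ql _ sq, ql _ sq').
  rewrite inE map_f // => /(_ isT)/implyP; rewrite -almost_disjointE //; apply.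
  by apply: contra ss' => /eqP /line_set_lines_inj -> //; exact: (mem_subseq qs).
rewrite inE => /mapP[s sq ->]; apply/forall_inP => f; rewrite inE => /mapP[s' sq' ->].
have [[_ ss] [_ ss']] := (ql _ sq, ql _ sq').
apply/implyP => ne; rewrite -almost_disjointE //.
have sym x y : almost_disjoint x y -> x \in q -> y \in q -> almost_disjoint y x.
  move=> + xq yq; have [[_ xs] [_ ys]] := (ql _ xq, ql _ yq).
  by rewrite !almost_disjointE // setIC.
have lt_ad x y : x \in q -> y \in q -> index x q < index y q -> almost_disjoint x y.
  move=> xq yq xy; have /(pairwiseP [::])/(_ (index x q) (index y q)) := pq.
  by rewrite !inE !index_mem xq yq !nth_index //; apply.
case: (ltngtP (index s q) (index s' q)) => [||ss'E].
- exact: lt_ad.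
- by move=> /(lt_ad _ _ sq' sq) /sym; apply.
by rewrite (@index_inj _ s q s s') ?eqxx in ne.
Qed.

Lemma space_of_ex (H : {set {set 'I_N}}) : linear_space H ->
  exists2 q, subseq q (lines N) & H = space_of q.
Proof.
case/andP=> /forall_inP big _; exists [seq s <- lines N | line_set s \in H].
  exact: filter_subseq.
apply/setP => e; rewrite inE; apply/idP/mapP => [eH|[s]]; last first.
  by rewrite mem_filter => /andP[sH _] ->.
have [ss se] := line_set_val e; exists [seq val i | i <- enum e]; last by rewrite se.
by rewrite mem_filter se eH mem_lines ss andbT -card_line_set // se big.
Qed.

Lemma big_linear_spaces (P : pred {set {set 'I_N}}) F :
  \sum_(H | linear_space H && P H) F H =
  \sum_(q <- linear_spaces N | P (space_of q)) F (space_of q).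
Proof.
rewrite big_mkcondr [RHS]big_mkcond.
apply: (@big_cliques _ _ _ _ _ _ (fun H => if P H then F H else 0)).
- exact: lines_uniq.
- exact: line_set_lines_inj.
- exact: linear_space_of.
exact: space_of_ex.
Qed.

End ListModel.

(* [undup] keeps last occurrences, so each list is a rotation of an orbit of l,
   and the rotation ending in its maximum occurs exactly once.  Nothing is proved
   about [cycles]: its values are checked by [is_cycles]. *)
Definition cycles n (l : seq nat) : seq (seq nat) :=
  sort (fun c1 c2 : seq nat => size c2 <= size c1)
    [seq c <- [seq undup (traject (nth 0 l) x n) | x <- iota 0 n]
       | all (geq (last 0 c)) c].

Definition is_cycles n (l : seq nat) (cs : seq (seq nat)) : bool :=
  [&& all (fcycle (nth 0 l)) cs, [::] \notin cs & perm_eq (flatten cs) (iota 0 n)].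

(** The list is independent of a, so one evaluation serves all a. As [cycles] sorts by length,
    permutations of one cycle type yield equal terms, which [tally] later merges. *)
Definition burnside_terms n : seq (seq nat * nat) :=
  let Q := linear_spaces n in
  flatten [seq [seq (map size (cycles n l), size q + size (isolated n q))
                  | q <- Q & stable n l q]
             | l <- permutations (iota 0 n)].

(** * Permutations and their cycles as lists *)

Section PermutationLists.

Variable n : nat.
Local Notation N := n.+1.
Local Notation points := (iota 0 N).
Implicit Types (s : seq nat) (q : seq (seq nat)) (i j : 'I_N) (p : {perm 'I_N}).

Lemma card_space_of q : subseq q (lines N) -> #|space_of n q| = size q.
Proof.
move=> qs; rewrite -(size_map (@line_set n)) cardsE; apply/card_uniqP.
rewrite map_inj_in_uniq; first by rewrite (subseq_uniq qs) ?lines_uniq.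
by move=> x y /(mem_subseq qs) xs /(mem_subseq qs) ys; apply: line_set_lines_inj.
Qed.

Lemma line_points q s : subseq q (lines N) -> s \in q -> subseq s points.
Proof. by move=> qs /(mem_subseq qs); rewrite mem_lines => /andP[]. Qed.

Lemma card_isolated q : subseq q (lines N) ->
  #|~: cover (space_of n q)| = size (isolated N q).
Proof.
move=> qs; rewrite -(@card_line_set n); last exact: filter_subseq.
apply: eq_card => i; rewrite in_setC mem_line_set; last first.
  by move=> x; rewrite mem_filter => /andP[].
rewrite mem_filter mem_iota /= add0n ltn_ord andbT; congr (~~ _).
apply/bigcupP/hasP => [[e]|[s sq si]].
  rewrite inE => /mapP[s sq ->]; have ss := line_points qs sq.
  by rewrite mem_line_set => [si|]; [exists s | exact: mem_subseq].
exists (line_set n s); first by rewrite inE map_f.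
by rewrite mem_line_set //; exact/mem_subseq/(line_points qs).
Qed.

Definition list_of p : seq nat := [seq val (p i) | i <- enum 'I_N].

Lemma nth_list_of p i : nth 0 (list_of p) i = p i.
Proof. by rewrite (nth_map i) ?size_enum_ord ?nth_ord_enum. Qed.

Lemma list_of_perm p : perm_eq (list_of p) points.
Proof.
rewrite -val_enum_ord /list_of map_comp perm_map //.
apply: uniq_perm; rewrite ?enum_uniq ?(map_inj_uniq (@perm_inj _ p)) ?enum_uniq //.
move=> i; rewrite mem_enum; apply/mapP; exists (p^-1 i)%g; rewrite ?mem_enum //.
by rewrite permKV.
Qed.

(** [list_of] is injective into the permutations of [points], and both sides have n.+1 factorial
    elements. *)
Lemma big_list_of (F : seq nat -> nat) :
  \sum_p F (list_of p) = \sum_(l <- permutations points) F l.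
Proof.
have list_inj : injective list_of.
  move=> p p' pp'; apply/permP => i; apply: val_inj.
  by rewrite /= -!nth_list_of pp'.
rewrite -big_enum -(big_map list_of predT F).
apply: perm_big; apply: uniq_perm; rewrite ?permutations_uniq //.
  by rewrite map_inj_uniq ?enum_uniq.
have [] // := @uniq_min_size _ (map list_of (enum {perm 'I_N})) (permutations points).
- by rewrite map_inj_uniq ?enum_uniq.
- by move=> _ /mapP[p _ ->]; rewrite mem_permutations list_of_perm.
by rewrite size_permutations ?iota_uniq // size_iota size_map -cardE card_Sn.
Qed.

Lemma permute_line_set p s : subseq s points ->
  p @: line_set n s = line_set n (permute N (list_of p) s).
Proof.
move=> ss; apply/setP => j; rewrite [RHS]mem_line_set; last first.
  by move=> x; rewrite mem_filter => /andP[].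
rewrite mem_filter mem_iota /= add0n ltn_ord andbT.
apply/imsetP/mapP => [[i]|[x xs]].
  rewrite mem_line_set => [si ->|]; last exact: mem_subseq.
  by exists (val i); rewrite ?nth_list_of.
have := mem_subseq ss xs; rewrite mem_iota /= add0n => xn.
rewrite (nth_list_of p (Ordinal xn)) => /val_inj->.
by exists (Ordinal xn) => //; rewrite mem_line_set //; exact: mem_subseq.
Qed.

Lemma size_permute p s : subseq s points -> size (permute N (list_of p) s) = size s.
Proof.
move=> ss; rewrite -!(@card_line_set n) ?filter_subseq // -permute_line_set //.
by rewrite card_imset //; exact: perm_inj.
Qed.

Lemma stable_list_of p q : subseq q (lines N) ->
  ([set p @: (e : {set _}) | e in space_of n q] == space_of n q) =
  stable N (list_of p) q.
Proof.
move=> qs; have lineP s : s \in q -> permute N (list_of p) s \in lines N.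
  move=> /(mem_subseq qs); rewrite !mem_lines => /andP[s1 ss].
  by rewrite size_permute // s1 filter_subseq.
have memE s : s \in q ->
    (permute N (list_of p) s \in q) = (p @: line_set n s \in space_of n q).
  move=> sq; rewrite permute_line_set ?(line_points qs) //.
  rewrite (mem_decode (s := lines N)) ?lineP //; first exact: line_set_lines_inj.
  exact: mem_subseq.
rewrite eqEcard card_imset ?leqnn ?andbT; last exact: imset_perm_inj.
apply/subsetP/allP => [H s sq|H _ /imsetP[e eq ->]].
  by rewrite memE //; apply: H; apply: imset_f; rewrite inE map_f.
by move: eq; rewrite inE => /mapP[s sq ->]; rewrite -memE ?H.
Qed.

Lemma is_cycles_list_of p cs : is_cycles N (list_of p) cs ->
  let ds := [seq [seq inord x : 'I_N | x <- c] | c <- cs] in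
  [/\ all (fcycle p) ds, [::] \notin ds, perm_eq (flatten ds) (enum 'I_N)
    & map size ds = map size cs].
Proof.
case/and3P => /allP cyc cs0 csT ds.
have cE c : c \in cs -> c = [seq val i | i <- [seq inord x : 'I_N | x <- c]].
  move=> ccs; rewrite -map_comp -[LHS]map_id; apply/eq_in_map => x xc /=.
  rewrite inordK //; have : x \in flatten cs by apply/flattenP; exists c.
  by rewrite (perm_mem csT) mem_iota.
split.
- apply/allP => _ /mapP[c ccs ->]; have := cyc c ccs.
  rewrite {1}(cE c ccs) cycle_map; congr (is_true _); apply: eq_cycle => i j /=.
  by rewrite nth_list_of (inj_eq val_inj).
- apply: contra cs0 => /mapP[[|//] ccs _]; exact: ccs.
- apply: (perm_map_inj val_inj); rewrite val_enum_ord map_flatten -map_comp.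
  by rewrite (_ : map _ cs = cs) //; rewrite -[RHS]map_id; apply/eq_in_map => c /cE.
by rewrite -map_comp; apply: eq_map => c /=; rewrite size_map.
Qed.

End PermutationLists.

Lemma R_burnside_terms n a :
    all (fun l => is_cycles n.+1 l (cycles n.+1 l)) (permutations (iota 0 n.+1)) ->
  R n.+1 a * (n.+1)`! =
  \sum_(x <- burnside_terms n.+1) shifted_denumerant a x.1 x.2.
Proof.
move=> /allP cyc; rewrite R_fixed_points // big_flatten big_map /= -big_list_of.
have list_perm (p : {perm 'I_n.+1}) : list_of p \in permutations (iota 0 n.+1).
  by rewrite mem_permutations list_of_perm.
apply: eq_bigr => p _; rewrite big_map big_filter.
have [/(card_fixed_configs a) fix0 {}/fix0 fix0 {}/fix0 fix0 sz] :=
  is_cycles_list_of (cyc _ (list_perm p)).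
rewrite fix0 big_linear_spaces sz big_seq_cond [RHS]big_seq_cond.
apply: eq_big => [q|q /andP[qs _]].
  case: (boolP (q \in _)) => //=; rewrite mem_cliques ?lines_uniq //.
  by case/andP=> qs _; rewrite stable_list_of.
move: qs; rewrite mem_cliques ?lines_uniq // => /andP[qs _].
by rewrite card_space_of // card_isolated.
Qed.

(** * Verification of the initial values *)

Fixpoint down_to0 (m : nat) : seq nat :=
  if m is m'.+1 then m :: down_to0 m' else [:: 0].

(* [denumerant_table l M] lists the values of [denumerant l] at M, ..., 0. *)
Fixpoint denumerant_table (l : seq nat) (M : nat) : seq N :=
  if l is d :: l' then
    foldr (fun x acc => (x + nth 0 acc d.-1)%num :: acc) [::] (denumerant_table l' M)
  else [seq if x is 0 then 1%num else 0%num | x <- down_to0 M].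

Lemma nth_down_to0 (f : nat -> nat) M k :
  nth 0 (map f (down_to0 M)) k = if k <= M then f (M - k) else 0.
Proof.
elim: M k => [|M IH] [|k] //=.
by rewrite nth_nil.
Qed.

(** When the fold reaches argument s, [acc] holds the values at s - 1, ..., 0, so index d - 1 gives
    the value at s - d, and the default 0 covers d > s. This is [denumerant_rec]. *)
Lemma denumerant_tableE l M : all (leq 1) l ->
  map N.to_nat (denumerant_table l M) = map (denumerant l) (down_to0 M).
Proof.
elim: l => [_|d l IH /andP[d_gt0 /IH {}IH]] /=.
  by rewrite -map_comp; apply: eq_map => -[].
suff H t s : map N.to_nat t = map (denumerant l) (down_to0 s) ->
    map N.to_nat (foldr (fun x acc => (x + nth 0 acc d.-1)%num :: acc) [::] t) =
    map (denumerant (d :: l)) (down_to0 s) by exact: H.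
elim: s t => [|s IHs] t.
  case: t => [//|x [|//]] [x0]; rewrite -[RHS]/[:: denumerant (d :: l) 0].
  rewrite denumerant_rec // leqNgt d_gt0 -x0 [foldr _ _ _]/= nth_nil.
  by rewrite N.add_0_r /= addn0.
case: t => [//|x t] [xs /IHs ts].
set acc := foldr _ _ _ in ts; rewrite [foldr _ _ _]/= -/acc.
rewrite -[RHS]/(denumerant (d :: l) s.+1 :: map (denumerant (d :: l)) (down_to0 s)).
rewrite [LHS]/= ts; congr (_ :: _).
have -> : N.to_nat (x + nth 0%num acc d.-1)%num =
    N.to_nat x + nth 0 (map N.to_nat acc) d.-1.
  have -> : nth 0 (map N.to_nat acc) d.-1 = N.to_nat (nth 0%num acc d.-1).
    case: (ltnP d.-1 (size acc)) => dacc; first by rewrite (nth_map 0%num).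
    by rewrite !nth_default // size_map.
  lia.
rewrite ts xs nth_down_to0 [RHS]denumerant_rec //.
have -> : (d <= s.+1) = (d.-1 <= s) by lia.
by have -> : s.+1 - d = s - d.-1 by lia.
Qed.

Lemma big_tally (X : eqType) (s : seq X) (F : X -> nat) :
  \sum_(x <- s) F x = \sum_(y <- tally s) y.2 * F y.1.
Proof.
rewrite -(perm_big _ (tallyK s)) big_flatten big_map.
by apply: eq_bigr => y _; rewrite big_nseq iter_addn_0 mulnC.
Qed.

Implicit Types (ts : seq (seq nat * nat * nat)) (L : seq nat).

Definition weighted_sum ts a : nat :=
  \sum_(x <- ts) x.2 * shifted_denumerant a x.1.1 x.1.2.

Definition tabulate M ts : seq (seq N * nat * N) :=
  [seq (denumerant_table x.1.1 M, x.1.2, N.of_nat x.2) | x <- ts].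

Definition weighted_sum_tab (V : seq (seq N * nat * N)) (i : nat) : N :=
  foldr (fun y acc => y.2 * nth 0 y.1.1 (i + y.1.2)%nat + acc)%num 0%num V.

Lemma weighted_sum_tabE M ts i : all (fun x => all (leq 1) x.1.1) ts -> i <= M ->
  N.to_nat (weighted_sum_tab (tabulate M ts) i) = weighted_sum ts (M - i).
Proof.
move=> + iM; elim: ts => [|[[l k] m] ts IH]; first by rewrite /weighted_sum big_nil.
case/andP=> /= lP /IH {}IH; rewrite /weighted_sum big_cons -/(weighted_sum _ _) -IH /=.
have -> : shifted_denumerant (M - i) l k =
    N.to_nat (nth 0%num (denumerant_table l M) (i + k)).
  have -> : N.to_nat (nth 0%num (denumerant_table l M) (i + k)) =
      nth 0 (map N.to_nat (denumerant_table l M)) (i + k).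
    case: (ltnP (i + k) (size (denumerant_table l M))) => sz.
      by rewrite (nth_map 0%num).
    by rewrite !nth_default // size_map.
  rewrite denumerant_tableE // nth_down_to0 /shifted_denumerant subnDA.
  by rewrite leq_subRL.
rewrite -[in RHS](Nnat.Nat2N.id m); lia.
Qed.

Lemma base_identity (b : bool) (S : N) (a H : nat) :
  let A := N.of_nat a in
  (8 * S + 6158 * (A * A * A) + (if b then 43638 else 43608) * A)%num =
  (875 * (A * A * A * A) + 23542 * (A * A) + N.of_nat H)%num ->
  (8 * N.to_nat S + 6158 * (a * a * a) + (if b then 6 * 7273 else 6 * 7268) * a =
    875 * (a * a * a * a) + 2 * 11771 * (a * a) + H)%N.
Proof.
have c1 : N.to_nat 6158 = 6158%N by vm_compute.
have c2 : N.to_nat 11771 = 11771%N by vm_compute.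
have c3 : N.to_nat 7273 = 7273%N by vm_compute.
have c4 : N.to_nat 7268 = 7268%N by vm_compute.
by rewrite -c1 -c2 -c3 -c4 => {c1 c2 c3 c4} A; case: b; rewrite /A; lia.
Qed.

(* The formula multiplied by 960. *)
Definition base_check M L ts : bool :=
  let V := tabulate M ts in
  let LN := map N.of_nat L in
  [&& size L == 60,
      all (fun x => [&& all (fun d => (0 < d) && (d %| 60)) x.1.1,
                        size x.1.1 <= 5 & x.1.2 <= 10]) ts
    & all (fun i =>
        let a := M - i in let A := N.of_nat a in
        N.eqb (8 * weighted_sum_tab V i + 6158 * (A * A * A)
                 + (if odd a then 43638 else 43608) * A)%num
              (875 * (A * A * A * A) + 23542 * (A * A) + nth 0 LN (a %% 60)%nat)%num)
        (iota 0 (M - 2))].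

(** * Quasi-polynomials *)

Local Open Scope ring_scope.

Section Differences.

Variables (V : zmodType) (T : nat).
Implicit Types (w : nat -> V) (j n s : nat).

Definition diff w n : V := w (n + T)%N - w n.

Definition quasipoly j w := forall n, iter j diff w n = 0.

Lemma eq_iter_diff w w' j : w =1 w' -> iter j diff w =1 iter j diff w'.
Proof. by move=> ww'; elim: j => //= j IH n; rewrite /diff !IH. Qed.

Lemma quasipolyS j w : quasipoly j.+1 w <-> quasipoly j (diff w).
Proof. by split=> H n; have := H n; rewrite iterSr. Qed.

Lemma quasipoly_leq j k w : (j <= k)%N -> quasipoly j w -> quasipoly k w.
Proof.
move=> /subnK <- wj; elim: (k - j)%N => //= i IH n.
by rewrite addSn /= /diff !IH subrr.
Qed.

Lemma eq_quasipoly j w w' : w =1 w' -> quasipoly j w -> quasipoly j w'.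
Proof. by move=> ww' H n; rewrite -(eq_iter_diff j ww') H. Qed.

Lemma quasipolyD j w w' : quasipoly j w -> quasipoly j w' ->
  quasipoly j (fun n => w n + w' n).
Proof.
elim: j w w' => [|j IH] w w' => [wj wj' n|].
  by rewrite /= (wj n : w n = 0) (wj' n : w' n = 0) addr0.
rewrite !quasipolyS => wj wj'; apply: eq_quasipoly (IH _ _ wj wj') => n.
by rewrite /diff opprD addrACA.
Qed.

Lemma quasipoly0 j : quasipoly j (fun=> 0).
Proof. exact: (@quasipoly_leq 0). Qed.

Lemma quasipolyN j w : quasipoly j w -> quasipoly j (fun n => - w n).
Proof.
elim: j w => [|j IH] w; first by move=> wj n; rewrite /= (wj n : w n = 0) oppr0.
rewrite !quasipolyS => wj; apply: eq_quasipoly (IH _ wj) => n.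
by rewrite /diff opprD opprK.
Qed.

Lemma quasipoly_shift j w s : quasipoly j w -> quasipoly j (fun n => w (n + s)%N).
Proof.
elim: j w => [|j IH] w; first by move=> wj n; exact: wj.
rewrite !quasipolyS => wj; apply: eq_quasipoly (IH _ wj) => n.
by rewrite /diff addnAC.
Qed.

Lemma quasipoly_sum j (I : eqType) (r : seq I) (F : I -> nat -> V) :
    {in r, forall i, quasipoly j (F i)} ->
  quasipoly j (fun n => \sum_(i <- r) F i n).
Proof.
elim: r => [_|i r IH Fj].
  by apply: eq_quasipoly (quasipoly0 j) => n; rewrite big_nil.
have Fr : {in r, forall i, quasipoly j (F i)}.
  by move=> k kr; apply: Fj; rewrite inE kr orbT.
apply: eq_quasipoly (quasipolyD (Fj i (mem_head i r)) (IH Fr)) => n.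
by rewrite big_cons.
Qed.

Lemma quasipolyMn j w k : quasipoly j w -> quasipoly j (fun n => w n *+ k).
Proof.
move=> wj; elim: k => [|k IH]; first exact: quasipoly0.
by apply: eq_quasipoly (quasipolyD wj IH) => n; rewrite mulrS.
Qed.

Lemma quasipoly_eq0 j w : (0 < T)%N -> quasipoly j w ->
  (forall n, (n < T * j)%N -> w n = 0) -> forall n, w n = 0.
Proof.
move=> T_gt0; elim: j w => [|j IH] w wj w0; first exact: wj.
have dw : forall n, diff w n = 0.
  apply: IH; first exact/quasipolyS.
  by move=> n nj; rewrite /diff !w0 ?subrr //; nia.
elim/ltn_ind => n IHn; case: (ltnP n T) => nT; first by apply: w0; nia.
have := dw (n - T)%N; rewrite /diff subnK // (IHn (n - T)%N) ?subr0 //; lia.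
Qed.

End Differences.

Lemma denumerant_telescope d l s t : (0 < d)%N ->
  denumerant (d :: l) (s + t * d) =
  (denumerant (d :: l) s + \sum_(i < t) denumerant l (s + i.+1 * d))%N.
Proof.
move=> d_gt0; elim: t => [|t IH]; first by rewrite big_ord0 !addn0.
have -> : (\sum_(i < t.+1) denumerant l (s + i.+1 * d) =
    \sum_(i < t) denumerant l (s + i.+1 * d) + denumerant l (s + t.+1 * d))%N.
  by rewrite big_ord_recr.
rewrite [RHS]addnA -IH denumerant_rec // ifT; last by rewrite mulSn addnCA leq_addr.
by rewrite addnC; congr (_ + _)%N; congr denumerant; rewrite mulSn addnCA addKn.
Qed.

(* The shift by 1 discards the value at 0 of [denumerant [::]], which is the
   only obstruction to exact quasi-polynomiality. *)
Lemma quasipoly_denumerant (A : pzRingType) T l :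
    all (fun d => (0 < d)%N && (d %| T)%N) l ->
  quasipoly T (size l) (fun n => (denumerant l n.+1)%:R : A).
Proof.
elim: l => [_ n //|d l IH] /andP[/andP[d_gt0 /dvdnP[t Tt]] /IH {}IH].
apply/quasipolyS; apply: (@eq_quasipoly _ _ _
    (fun n => \sum_(i < t) (denumerant l (n + i.+1 * d).+1)%:R)) => [n|].
  rewrite /diff Tt; cbv beta; rewrite -[(n + t * d).+1]/(n.+1 + t * d)%N.
  rewrite denumerant_telescope // natrD addrC addKr natr_sum.
  by apply: eq_bigr => i _; rewrite addSn.
apply: quasipoly_sum => i _; exact: (quasipoly_shift (i.+1 * d) IH).
Qed.

Lemma quasipoly_quartic (A : comPzRingType) T (c4 c3 c2 : A) (c1 c0 : nat -> A) :
    (forall n, c1 (n + T)%N = c1 n) -> (forall n, c0 (n + T)%N = c0 n) ->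
  quasipoly T 5 (fun n => c4 * n%:R ^+ 4 + c3 * n%:R ^+ 3 + c2 * n%:R ^+ 2
                          + c1 n * n%:R + c0 n).
Proof. by move=> c1T c0T n; rewrite /= /diff !c1T !c0T !natrD; ring. Qed.

Definition quartic (c0 : nat -> rat) (a : nat) : rat :=
    175%:R / 192%:R * a%:R ^+ 4 - 3079%:R / 480%:R * a%:R ^+ 3
    + 11771%:R / 480%:R * a%:R ^+ 2
    + bracket [:: - (7268%:R / 160%:R); - (7273%:R / 160%:R)] a * a%:R
    + c0 a.

Lemma bracket_mod s T a : (size s %| T)%N -> bracket s (a + T) = bracket s a.
Proof. by move=> /dvdnP[k ->]; rewrite /bracket addnC modnMDl. Qed.

Definition constant_term L a : rat := 1 / 960%:R * bracket [seq n%:R | n <- L] a.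

Lemma constant_termE L a : size L = 60 ->
  constant_term L a = 1 / 960%:R * (nth 0%N L (a %% 60))%:R.
Proof.
move=> sL; rewrite /constant_term /bracket size_map sL.
by rewrite (nth_map 0%N) // sL ltn_mod.
Qed.

Lemma bracket_odd x y a : bracket [:: x; y] a = if odd a then y else x.
Proof. by rewrite /bracket modn2; case: (odd a). Qed.

Lemma rat_identity (b : bool) (S a H : nat) :
  (8 * S + 6158 * (a * a * a) + (if b then 6 * 7273 else 6 * 7268) * a =
    875 * (a * a * a * a) + 2 * 11771 * (a * a) + H)%N ->
  S%:R = 120%:R * (175%:R / 192%:R * a%:R ^+ 4 - 3079%:R / 480%:R * a%:R ^+ 3
    + 11771%:R / 480%:R * a%:R ^+ 2
    + (if b then - (7273%:R / 160%:R) else - (7268%:R / 160%:R)) * a%:R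
    + 1 / 960%:R * H%:R) :> rat.
Proof.
by move=> /(congr1 (fun m => m%:R : rat)); case: b; rewrite !(natrD, natrM); lra.
Qed.

Lemma base_values M L ts a : base_check M L ts -> (2 < a <= M)%N ->
  (weighted_sum ts a)%:R = 120%:R * quartic (constant_term L) a.
Proof.
case/and3P=> /eqP sL /allP tsP /allP ck /andP[a2 aM].
have ts1 : all (fun x => all (leq 1) x.1.1) ts.
  by apply/allP => x /tsP/and3P[/allP xd _ _]; apply/allP => d /xd/andP[].
have := weighted_sum_tabE (i := M - a) ts1 (leq_subr _ _); rewrite subKn // => <-.
have am : (a %% 60 < size L)%N by rewrite sL ltn_mod.
have /ck : (M - a)%N \in iota 0 (M - 2) by rewrite mem_iota; lia.
rewrite /= subKn // (nth_map 0%N) // => /N.eqb_eq/(@base_identity (odd a) _ a _).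
by move=> /rat_identity ->; rewrite /quartic bracket_odd constant_termE.
Qed.

(* The shift by 11 makes every argument a - k with k <= 10 positive. *)
Lemma weighted_sum_quasipoly ts :
    all (fun x => [&& all (fun d => (0 < d) && (d %| 60))%N x.1.1,
                      (size x.1.1 <= 5)%N & (x.1.2 <= 10)%N]) ts ->
  quasipoly 60 5 (fun n => (weighted_sum ts (n + 11))%:R : rat).
Proof.
move=> /allP tsP.
apply: (@eq_quasipoly _ _ _ (fun n => \sum_(x <- ts)
   (denumerant x.1.1 (n + (10 - x.1.2)).+1)%:R *+ x.2)) => [n|].
  rewrite /weighted_sum natr_sum big_seq [RHS]big_seq.
  apply: eq_bigr => x /tsP /and3P[_ _ x10].
  rewrite natrM mulr_natl /shifted_denumerant ifT; last by lia.
  by congr (_%:R *+ _); congr denumerant; lia.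
apply: quasipoly_sum => x /tsP/and3P[xd x5 x10]; apply: quasipolyMn.
apply: (@quasipoly_shift _ _ _ (fun n => (denumerant x.1.1 n.+1)%:R : rat)).
exact: quasipoly_leq x5 (quasipoly_denumerant _ xd).
Qed.

(* 310 = 10 + 60 * 5: the quasi-polynomials start at 11 and have order 5. *)
Lemma weighted_sum_quartic L ts a : base_check 310 L ts -> (2 < a)%N ->
  (weighted_sum ts a)%:R = 120%:R * quartic (constant_term L) a.
Proof.
move=> ck a2; case: (leqP a 310) => a310; first by apply: base_values ck _; rewrite a2.
have /and3P[/eqP sL tsP _] := ck.
pose w n : rat :=
  (weighted_sum ts (n + 11))%:R + - (120%:R * quartic (constant_term L) (n + 11)).
suff w0 : forall n, w n = 0.
  have := w0 (a - 11)%N; rewrite /w subnK ?(leq_trans _ (ltnW a310)) //.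
  by move=> /eqP; rewrite subr_eq0 => /eqP.
apply: (@quasipoly_eq0 _ 60 5) => // [|n n300].
  apply: quasipolyD; first exact: weighted_sum_quasipoly.
  apply: quasipolyN.
  apply: (@quasipoly_shift _ _ _ (fun n => 120%:R * quartic (constant_term L) n)).
  pose b : seq rat := [:: - (7268%:R / 160%:R); - (7273%:R / 160%:R)].
  apply: eq_quasipoly (@quasipoly_quartic rat 60 (120%:R * (175%:R / 192%:R))
    (120%:R * - (3079%:R / 480%:R)) (120%:R * (11771%:R / 480%:R))
    (fun n => 120%:R * bracket b n) (fun n => 120%:R * constant_term L n) _ _) => n.
  - have distr (q u v z A x y : rat) :
        q * u * A ^+ 4 + q * - v * A ^+ 3 + q * z * A ^+ 2
        + q * x * A + q * y =
        q * (u * A ^+ 4 - v * A ^+ 3 + z * A ^+ 2 + x * A + y) by ring.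
    exact: distr.
  - by rewrite bracket_mod.
  by rewrite /constant_term bracket_mod // size_map sL.
by rewrite /w (base_values ck) ?subrr //; lia.
Qed.

Lemma R5_weighted_sum a : (R 5 a * 120)%N = weighted_sum (tally (burnside_terms 5)) a.
Proof.
rewrite -[120%N]/(5`!) R_burnside_terms; last by vm_compute.
exact: big_tally.
Qed.

Lemma R5_quartic L a : base_check 310 L (tally (burnside_terms 5)) -> (2 < a)%N ->
  (R 5 a)%:R = quartic (constant_term L) a.
Proof.
move=> ck a2; have := weighted_sum_quartic ck a2; rewrite -R5_weighted_sum natrM mulrC.
by apply: mulfI; rewrite pnatr_eq0.
Qed.

Theorem theorem7p6 (a : nat) (ha : (3 <= a)%N) :
  (R 5 a)%:R =
    175%:R / 192%:R * a%:R ^+ 4 - 3079%:R / 480%:R * a%:R ^+ 3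
    + 11771%:R / 480%:R * a%:R ^+ 2
    + bracket [:: - (7268%:R / 160%:R); - (7273%:R / 160%:R)] a * a%:R
    + h a :> rat.
Proof.
rewrite /h; set L := (X in map _ X).
have := @R5_quartic L a _ ha; rewrite /quartic /constant_term.
by apply; vm_compute.
Qed.
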